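(* Let $r\ge 2$ be an integer. Then there exists an explicitly constructible $\mathcal{F}^{(r)}(n,2)$-universal ($r$-uniform) hypergraph on $O(n)$ vertices and $O(n^{r/2})$ edges.
   Context: An $r$-uniform hypergraph has a finite vertex set and a set of edges each of which is an $r$-element subset of the vertex set. $\mathcal{F}^{(r)}(n,\Delta)$ denotes the family of all $r$-uniform hypergraphs on at most $n$ vertices with maximum vertex degree at most $\Delta$; here $\Delta=2$. An $r$-uniform hypergraph $H$ is called $\mathcal{F}$-universal, for a family $\mathcal{F}$ of $r$-uniform hypergraphs, if it contains every $F\in\mathcal{F}$ as a copy, i.e. for each $F\in\mathcal{F}$ there is an injective map $V(F)\to V(H)$ sending edges of $F$ to edges of $H$ (the copy need not be induced). The statement is for every $n$, asymptotically as $n\to\infty$; constants in the $O$-notation depend only on $r$. ''Explicitly constructible'' is used in the usual informal sense: the hypergraphs are given by an explicit deterministic construction, rather than by a probabilistic existence argument. *)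

(* Defs.v *)
From mathcomp Require Import all_boot.

Set Implicit Arguments.
Unset Strict Implicit.
Unset Printing Implicit Defensive.

Record hypergraph := Hypergraph {
  vert : finType;
  edges : {set {set vert}}
}.

Definition uniform (r : nat) (H : hypergraph) : Prop :=
  forall e, e \in edges H -> #|e| = r.

Definition vdegree (H : hypergraph) (v : vert H) : nat :=
  #|[set e in edges H | v \in e]|.

(* The family F^(r)(n, D). *)
Definition bounded_family (r n D : nat) (F : hypergraph) : Prop :=
  [/\ uniform r F, #|vert F| <= n & forall v : vert F, vdegree v <= D].

Definition contains_copy (H F : hypergraph) : Prop :=
  exists f : vert F -> vert H,
    injective f /\ forall e, e \in edges F -> [set f x | x in e] \in edges H.

Definition universal (Fam : hypergraph -> Prop) (H : hypergraph) : Prop :=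
  forall F, Fam F -> contains_copy H F.

(* "Explicitly constructible" is read as "constructible in deterministic
   polynomial time".  The machine is a successor random-access machine whose
   memory cells are indexed by, and hold, natural numbers.  Its control flow is
   restricted to bounded loops, the body of Loop x c being run as many times as
   the value of cell x on entry; every program therefore terminates.  For
   polynomial time this is no restriction, since a loop can serve as a clock.
   There is deliberately no unit-cost addition or multiplication: a stored value
   exceeds the largest input and program constant by at most the number of
   steps, so unit cost is a fair measure of time. *)
Inductive cmd : Type :=
| Const of nat & nat        (* Const x k : M[x] := k *)
| Copy of nat & nat         (* Copy x y  : M[x] := M[y] *)
| Succ of nat               (* Succ x    : M[x] := M[x] + 1 *)
| Pred of nat               (* Pred x    : M[x] := M[x] - 1, truncated *)
| Fetch of nat & nat       (* Fetch x y : M[x] := M[M[y]] *)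
| Store of nat & nat       (* Store x y : M[M[x]] := M[y] *)
| Seq of cmd & cmd
| Loop of nat & cmd.

Definition memory := nat -> nat.

Definition upd (m : memory) (x v : nat) : memory :=
  fun y => if y == x then v else m y.

(* Final memory and number of steps. *)
Fixpoint exec (c : cmd) (m : memory) : memory * nat :=
  match c with
  | Const x k => (upd m x k, 1)
  | Copy x y => (upd m x (m y), 1)
  | Succ x => (upd m x (m x).+1, 1)
  | Pred x => (upd m x (m x).-1, 1)
  | Fetch x y => (upd m x (m (m y)), 1)
  | Store x y => (upd m (m x) (m y), 1)
  | Seq c1 c2 =>
      let p1 := exec c1 m in
      let p2 := exec c2 p1.1 in
      (p2.1, p1.2 + p2.2)
  | Loop x c1 =>
      iter (m x) (fun p => let q := exec c1 p.1 in (q.1, p.2 + q.2)) (m, 1)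
  end.

(* Time is polynomial in the values (not the bit lengths) of the arguments: the
   argument n of a family of hypergraphs indexed by n counts as n, so that
   "polynomial" means polynomial in the size of the hypergraph.  The arguments
   are in cells 0, ..., k - 1, all other cells are 0, and the result is left in
   cell 0. *)
Definition poly_time (k : nat) (f : k.-tuple nat -> nat) : Prop :=
  exists (p : cmd) (d : nat), forall t : k.-tuple nat,
    let res := exec p (nth 0 t) in
    res.1 0 = f t /\ res.2 <= (sumn t + 2) ^ d.

(* For a tuple t = (n, v_1, ..., v_r), tests whether v_1, ..., v_r are the
   vertices of an edge of the n-th hypergraph.  If that hypergraph is r-uniform,
   the test fails as soon as some v_i is repeated or is not a vertex. *)
Definition edge_test (N : nat -> nat) (E : forall n, {set {set 'I_(N n)}})
    (r : nat) (t : r.+1.-tuple nat) : nat :=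
  let n := thead t in
  [set i : 'I_(N n) | val i \in behead t] \in E n.

(* The r-uniform hypergraphs with vertex set {0, ..., N n - 1} and edge set E n
   are given by one polynomial-time algorithm for the number of vertices and one
   for the edge relation; as r is fixed, listing all edges of the n-th one then
   also takes polynomial time if N is polynomially bounded. *)
Definition explicitly_constructible (r : nat) (N : nat -> nat)
    (E : forall n, {set {set 'I_(N n)}}) : Prop :=
  poly_time (fun t : 1.-tuple nat => N (thead t)) /\
  poly_time (edge_test E (r := r)).

(* Main.v *)
Require Import Defs.
From mathcomp Require Import all_boot all_order all_algebra.
From mathcomp Require Import reals exp.
From mathcomp Require Import zify ring lra.

Set Implicit Arguments.
Unset Strict Implicit.
Unset Printing Implicit Defensive.

(** The vertices of the universal hypergraph are labels: a label consists of a
    level, of a block of a first kind and a block of a second kind, and of a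
    place in the intersection of these two blocks. The blocks of each kind are
    nested; at level [j] there are about [n^(1/2) / t^(3j)] of each kind, where
    [t] is a constant. Two labels are near in one kind if their blocks of this
    kind are equal or one is next below the other. Edges are the sets of [r]
    labels that can be listed in pairs of labels that are near in both kinds;
    for odd [r] a last label is near one of the last pair in at least one kind.
    There are [O(n)] labels and [O(n)] such pairs ([size_pairs]), and
    [O(n^(3/2))] such triples at the end ([size_triples]), hence [O(n^(r/2))]
    edges.

    Let [F] have degrees at most 2, and pair the vertices in each of its edges.
    Consider the incidences of vertices with edges, and join them within each
    pair and, at a vertex of degree 2, with each other. This union of two
    matchings is bipartite ([two_colouring]). A 2-colouring of it makes each
    vertex point to at most one vertex in each of two functional graphs, such
    that the vertices of a pair point to each other, one in the first graph and
    the other in the second one, and a vertex left over points to one of the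
    last pair ([pointers]). So [F] is contained in the universal hypergraph as
    soon as its vertices have distinct labels such that each vertex is near its
    image in the first kind for the first graph, and in the second kind for the
    second graph ([near_labelling]).

    Such labels exist because functional graphs have small separators: the
    removal of one or two vertices of a heavy component lessens the excess
    weight of components considerably ([excess_cut]). Cutting both graphs at all
    scales gives levels that change by at most 1 along the graphs, such that the
    vertices of level less than [j] form components of weight at most [t^(5j)],
    although a vertex of level [j] has weight [t^(4j)] and the total weight is
    [O(n)] ([levels]). From the top scale downwards, each block is then split
    into [t^3] blocks of the next scale without splitting a component; by the
    Beck-Fiala theorem this can be done such that all intersections of a block
    of the first kind with one of the second kind have about the same weight,
    [O(t^(6j))] at scale [j] ([nested_blocks]). Hence [O(t^(2j))] places are
    enough for the vertices of level [j] there.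

    The coordinates of a label are obtained from its number by a few divisions,
    and all numbers that occur are bounded by polynomials in the input; so the
    edge relation is computed in polynomial time, by closure properties of the
    functions with this property ([computes_comp], [computes_iteri]). *)

(** * Colouring the union of two matchings *)

(** The union of two perfect matchings is a union of even cycles.  Its two
    classes of vertices on one cycle are two orbits of [g \o f]; the colour
    compares canonical elements of the two orbits. *)
Lemma two_colouring_free (T : finType) (f g : T -> T) :
  involutive f -> involutive g ->
  (forall x, f x != x) -> (forall x, g x != x) ->
  exists col : T -> bool,
    forall x, col (f x) = ~~ col x /\ col (g x) = ~~ col x.
Proof.
move=> fK gK f_free g_free.
pose h := g \o f.
have h_inj : injective h by apply: inj_comp; apply: can_inj.
have no_meet k x : f x != iter k h x.
  elim/ltn_ind: k x => -[|[|k]] IH x; first exact: f_free.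
    by rewrite eq_sym; exact: g_free.
  apply/eqP => Efx; have /eqP[] := IH k (leqW (leqnn _)) (h x).
  have -> : f (h x) = f (g (f x)) by [].
  by rewrite Efx -iterSr [iter k.+2 h x]iterS [h (iter _ _ _)]/= gK fK.
have hC := fconnect_sym h_inj.
pose rk x : nat := enum_rank (froot h x).
have rk_f x : rk (f x) != rk x.
  apply/eqP => /val_inj/enum_rank_inj/eqP; rewrite root_connect // hC => xfx.
  by have /eqP[] := no_meet (findex h x (f x)) x; rewrite iter_findex.
have rk_h x : rk (h x) = rk x.
  congr (val (enum_rank _)); apply/esym/eqP; rewrite root_connect //.
  exact: fconnect1.
have rk_g x : rk (g x) = rk (f x) by rewrite -[RHS]rk_h /h /= fK.
have rk_fg x : rk (f (g x)) = rk x by rewrite -rk_h /h /= fK gK.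
exists (fun x => rk x < rk (f x)) => x.
by rewrite fK rk_fg rk_g -leqNgt [in X in _ = X]leq_eqVlt (negPf (rk_f x)).
Qed.

(** Fixed points of [f] or [g] are the ends of the paths of the union; two
    copies of [T] joined at the ends reduce to cycles. *)
Lemma two_colouring (T : finType) (f g : T -> T) :
  involutive f -> involutive g ->
  exists col : T -> bool, forall x,
    (f x != x -> col (f x) = ~~ col x) /\ (g x != x -> col (g x) = ~~ col x).
Proof.
move=> fK gK.
pose ext (k : T -> T) (u : T * bool) :=
  if k u.1 == u.1 then (u.1, ~~ u.2) else (k u.1, u.2).
have extK k : involutive k -> involutive (ext k).
  move=> kK [x b]; rewrite /ext /=; case: (eqVneq (k x) x) => [Ek|nEk] /=.
    by rewrite Ek eqxx negbK.
  by rewrite kK eq_sym (negPf nEk).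
have ext_free k u : ext k u != u.
  case: u => x b; rewrite /ext /=; case: (eqVneq (k x) x) => [Ek|nEk] /=.
    by rewrite xpair_eqE eqxx; case: b.
  by rewrite xpair_eqE (negPf nEk).
have [col colP] := two_colouring_free (extK f fK) (extK g gK) (ext_free f) (ext_free g).
exists (fun x => col (x, true)) => x.
have [] := colP (x, true); rewrite /ext /= => Ef Eg.
by split=> [/negPf Ek|/negPf Ek]; [rewrite -Ef Ek|rewrite -Eg Ek].
Qed.

(** * Components of a functional graph inside a set of vertices *)

Section Components.
Variables (V : finType) (p : V -> V).
Implicit Types (B K S Y : {set V}) (w : V -> nat).

Lemma connect_closed (e : rel V) S x y :
  (forall a b, e a b -> a \in S -> b \in S) ->
  connect e x y -> x \in S -> y \in S.
Proof.
move=> eS /connectP[q]; elim: q x => [|z q IH] x /= => [_ -> //|].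
by case/andP=> exz ezq Ey xS; apply: IH ezq Ey (eS _ _ exz xS).
Qed.

Definition arc B : rel V := [rel x y | [&& x \in B, y \in B & p x == y]].

Definition link B : rel V :=
  [rel x y | [&& x \in B, y \in B & (p x == y) || (p y == x)]].

Definition component B x : {set V} := [set y | connect (link B) x y].

Definition components B : {set {set V}} := [set component B x | x in B].

(** The subtree that hangs from [v], or the whole component if [v] lies on its
    cycle. *)
Definition desc B v : {set V} := [set u | connect (arc B) u v].

Definition wt w S := \sum_(x in S) w x.

(** A component is charged from weight [s / 2] on: cutting one of weight [s] in
    the middle then gains a constant fraction of [s]. *)
Definition excess w s B := \sum_(K in components B) (2 * wt w K - s).

Lemma link_sym B : symmetric (link B).
Proof. by move=> x y; rewrite /link /= andbCA orbC. Qed.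

Lemma link_csym B : connect_sym (link B).
Proof. exact/sym_connect_sym/link_sym. Qed.

Lemma mem_component B x : x \in component B x.
Proof. by rewrite inE connect0. Qed.

Lemma component_sub B x : x \in B -> component B x \subset B.
Proof.
move=> xB; apply/subsetP => y; rewrite inE => cxy.
by apply: connect_closed cxy xB => a b /and3P[].
Qed.

Lemma component_eq B x y : y \in component B x -> component B y = component B x.
Proof.
rewrite inE => cxy; apply/setP => z; rewrite !inE.
by apply/esym/same_connect => //; exact: link_csym.
Qed.

Lemma components_sub B K : K \in components B -> K \subset B.
Proof. by case/imsetP=> x xB ->; exact: component_sub. Qed.

Lemma components_eq B K x : K \in components B -> x \in K -> K = component B x.
Proof. by case/imsetP=> y yB -> /component_eq. Qed.

Lemma components_triv B : trivIset (components B).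
Proof.
apply/trivIsetP => K K' cK cK' neq; rewrite -setI_eq0.
apply/eqP/setP => x; rewrite !inE; apply/negP => /andP[xK xK'].
by case/eqP: neq; rewrite (components_eq cK xK) (components_eq cK' xK').
Qed.

Lemma sub_link B B' : B' \subset B -> subrel (link B') (link B).
Proof.
by move=> sB x y /and3P[xB yB pxy]; rewrite /link /arc /= !(subsetP sB) ?xB ?yB.
Qed.

Lemma component_mono B B' x : B' \subset B -> component B' x \subset component B x.
Proof.
move=> sB; apply/subsetP => y; rewrite !inE; apply: connect_sub => a b lab.
by apply/connect1/(sub_link sB).
Qed.

Lemma components_mono B B' K' :
  B' \subset B -> K' \in components B' -> exists2 K, K \in components B & K' \subset K.
Proof.
move=> sB /imsetP[x xB ->]; exists (component B x); last exact: component_mono.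
by apply/imset_f/(subsetP sB).
Qed.

Lemma wt_sub w S S' : S \subset S' -> wt w S <= wt w S'.
Proof.
move=> sS; rewrite /wt [leqRHS](big_setID S) /= (setIidPr sS); exact: leq_addr.
Qed.

Lemma wtD w S S' : S' \subset S -> wt w S = wt w S' + wt w (S :\: S').
Proof. by move=> sS; rewrite /wt (big_setID S') /= (setIidPr sS). Qed.

(** The function [x |-> (2x - s)^+] is superadditive. *)
Lemma excess_disjoint w s (P : {set {set V}}) S :
  trivIset P -> (forall K, K \in P -> K \subset S) ->
  \sum_(K in P) (2 * wt w K - s) <= 2 * wt w S - s.
Proof.
move=> tP sP.
have le_sum : \sum_(K in P) wt w K <= wt w S.
  rewrite /wt -big_trivIset //; apply: wt_sub.
  by apply/bigcupsP => K KP; exact: sP.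
apply: (@leq_trans (2 * (\sum_(K in P) wt w K) - s)); last first.
  by rewrite leq_sub2r // leq_mul2l.
apply: (big_ind2 (fun a b => a <= 2 * b - s)) => // a b c d; lia.
Qed.

(** Each component of a smaller set lies in one of the larger set. *)
Lemma excess_refine w s B B' : B' \subset B ->
  excess w s B' <= \sum_(K in components B)
                     \sum_(K' in components B' | K' \subset K) (2 * wt w K' - s).
Proof.
move=> sB; under eq_bigr do rewrite big_mkcondr /=.
rewrite exchange_big /=; apply: leq_sum => K' cK'.
have [K cK sK] := components_mono sB cK'.
by rewrite (bigD1 K) //= sK leq_addr.
Qed.

Lemma excess_inside w s B K S :
  (forall K', K' \in components B -> K' \subset K ->
     K' \subset S \/ 2 * wt w K' <= s) ->
  \sum_(K' in components B | K' \subset K) (2 * wt w K' - s) <= 2 * wt w S - s.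
Proof.
move=> dich.
pose P := [set K' in components B | (K' \subset K) && (K' \subset S)].
apply: (@leq_trans (\sum_(K' in P) (2 * wt w K' - s))).
  rewrite big_mkcond [leqRHS]big_mkcond /=; apply: leq_sum => K' _.
  rewrite !inE; case: (boolP (K' \in components B)) => //= cK'.
  case: (boolP (K' \subset K)) => //= sK; have [->//|le] := dich _ cK' sK.
  by case: ifP => //; lia.
apply: excess_disjoint => [|K']; last by rewrite inE => /and3P[].
by apply: trivIsetS (components_triv B); apply/subsetP => K'; rewrite inE => /andP[].
Qed.

(** The price of raising weights, at a scale that may or may not be cut. *)
Lemma excess_mono w w' s B B' d :
  B' \subset B -> (forall x, w x <= w' x) ->
  \sum_x (w' x - w x) <= d ->
  excess w' s B' <= excess w s B + 2 * d.
Proof.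
move=> sB le_w le_d; apply: leq_trans (excess_refine w' s sB) _.
apply: (@leq_trans (\sum_(K in components B) (2 * wt w' K - s))).
  apply: leq_sum => K cK; apply: excess_inside => K' _ sK; by left.
have wt' S : wt w' S = wt w S + \sum_(x in S) (w' x - w x).
  by rewrite /wt -big_split /=; apply: eq_bigr => x _; rewrite subnKC.
apply: (@leq_trans (excess w s B +
                    \sum_(K in components B) 2 * \sum_(x in K) (w' x - w x))).
  rewrite /excess -big_split /=; apply: leq_sum => K _; rewrite wt'; lia.
rewrite leq_add2l -big_distrr /= leq_mul2l /=; apply: leq_trans le_d.
rewrite -big_trivIset ?components_triv //= [leqRHS](bigID (mem (cover (components B)))) /=.
exact: leq_addr.
Qed.

Lemma arc_desc B v x y : arc B x y -> y \in desc B v -> x \in desc B v.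
Proof.
by move=> axy; rewrite !inE; apply: connect_trans; exact: connect1.
Qed.

Lemma desc_arc B v x : x \in desc B v -> x != v ->
  arc B x (p x) && (p x \in desc B v).
Proof.
rewrite inE => /connectP[[|y q]] /= => [_ ->|]; first by rewrite eqxx.
case/andP=> axy pq Ev _; have Ey : p x = y by case/and3P: axy => _ _ /eqP.
by rewrite Ey axy inE; apply/connectP; exists q.
Qed.

Lemma desc_trans B u v : u \in desc B v -> desc B u \subset desc B v.
Proof.
move=> uv; apply/subsetP => x; move: uv; rewrite !inE => uv xu.
exact: connect_trans xu uv.
Qed.

Lemma desc_comp B v : desc B v \subset component B v.
Proof.
apply/subsetP => x; rewrite !inE link_csym; apply: connect_sub => a b.
by case/and3P=> aB bB pab; apply: connect1; rewrite /link /arc /= aB bB pab.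
Qed.

Lemma desc_mono B B' v : B' \subset B -> desc B' v \subset desc B v.
Proof.
move=> sB; apply/subsetP => x; rewrite !inE; apply: connect_sub => a b.
by case/and3P=> aB bB pab; apply: connect1; rewrite /link /arc /= !(subsetP sB) ?aB ?bB.
Qed.

(** Following [p] inside a component ends in a sink or in the unique cycle. *)
Lemma component_sink B K : K \in components B -> exists2 s, s \in K & K = desc B s.
Proof.
move=> cK; have [x xB EK] := imsetP cK.
have xK : x \in K by rewrite EK mem_component.
case: (@arg_maxnP _ x (mem K) (fun s => #|desc B s|) xK) => s sK s_max.
exists s => //; apply/eqP; rewrite eqEsubset (components_eq cK sK) desc_comp andbT.
apply/subsetP => y; rewrite inE => csy.
apply: (connect_closed _ csy); last by rewrite inE connect0.
move=> a b /and3P[aB bB /orP[/eqP pab|/eqP pba]] aD.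
  have [Ea|nas] := eqVneq a s; last first.
    by have := desc_arc aD nas; rewrite pab => /andP[].
  have asb : arc B s b by rewrite /link /arc /= -Ea aB bB pab eqxx.
  have bK : b \in K.
    rewrite (components_eq cK sK) inE; apply: connect1.
    by rewrite /link /arc /= -Ea aB bB pab eqxx.
  have sb : s \in desc B b by rewrite inE; exact: connect1.
  have /eqP -> : desc B s == desc B b.
    by rewrite eqEcard desc_trans //; exact: s_max.
  by rewrite inE connect0.
by apply: arc_desc aD; rewrite /link /arc /= aB bB pba eqxx.
Qed.

(** Removing a sink of the component leaves no cycle. *)
Lemma desc_acyclic B s u v :
  v \in desc B s -> v \in B :\ s ->
  u \in desc (B :\ s) v -> u != v -> v \notin desc (B :\ s) u.
Proof.
move=> vs vB uv nuv; apply/negP => vu.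
pose C := [set y in B :\ s | (y \in desc (B :\ s) v) && (v \in desc (B :\ s) y)].
have Cv : v \in C by rewrite inE vB andbb inE connect0.
have closedC a b : arc B a b -> a \in C -> b \in C.
  case/and3P=> aB bB /eqP pab; rewrite inE => /and3P[aBs av va].
  have [Ea|nav] := eqVneq a v.
    have /andP[] := desc_arc vu (contra_neq esym nuv).
    rewrite -Ea pab => /and3P[_ bBs _] bu; rewrite inE bBs.
    rewrite (subsetP (desc_trans uv)) //=; apply: (@arc_desc _ _ _ b).
      by rewrite /link /arc /= -Ea aBs bBs pab eqxx.
    by rewrite inE connect0.
  have /andP[] := desc_arc av nav; rewrite pab => /and3P[_ bBs _] bv.
  rewrite inE bBs bv /=; apply: (subsetP (desc_trans _)) va.
  by rewrite inE; apply: connect1; rewrite /link /arc /= aBs bBs pab eqxx.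
have : s \in C by move: vs; rewrite inE => /connect_closed; apply.
by rewrite !inE eqxx.
Qed.

(** A component is cut at its sink, and then at a vertex [v] with few
    descendants among those with many: the descendants of [v] fall into light
    components, and the rest has lost the weight of all of them. *)
Lemma excess_cut w h B K : K \in components B -> 4 * h < wt w K ->
  exists2 Y : {set V}, #|Y| <= 2 & excess w (4 * h) (B :\: Y) + 2 * h <= excess w (4 * h) B.
Proof.
move=> cK heavy.
have light_excess a b : a <= b -> b < h -> 2 * a <= 4 * h by lia.
suff [Y Y2 inK] : exists2 Y : {set V}, #|Y| <= 2 &
    \sum_(K' in components (B :\: Y) | K' \subset K) (2 * wt w K' - 4 * h) + 2 * h
      <= 2 * wt w K - 4 * h.
  exists Y => //; have := excess_refine w (4 * h) (subsetDl B Y).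
  rewrite (bigD1 K) //= => le1.
  rewrite [leqRHS](bigD1 K) //=.
  apply: leq_trans (leq_add le1 (leqnn _)) _; rewrite addnAC leq_add //.
  by apply: leq_sum => K0 _; apply: excess_inside => K' _ sK; left.
have [s sK EK] := component_sink cK.
have sB : s \in B by apply: (subsetP (components_sub cK)).
set B1 := B :\ s.
have sB1 : B1 \subset B by exact: subsetDl.
have [[v vKs vh]|none] := altP (@exists_inP _ (mem (K :\ s)) (fun v => h <= wt w (desc B1 v))).
- case: (@arg_minnP _ v (fun v => (v \in K :\ s) && (h <= wt w (desc B1 v)))
           (fun v => #|desc B1 v|)); first by apply/andP.
  move=> {vKs vh}v /andP[vKs v_heavy] v_min.
  have /setD1P[nvs vK] := vKs.
  have vB1 : v \in B1 by rewrite !inE nvs (subsetP (components_sub cK)).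
  exists [set s; v]; first by rewrite cards2; case: (s != v).
  have sB2 : B :\: [set s; v] \subset B1 by apply: setDS; rewrite sub1set set21.
  apply: (@leq_trans ((2 * wt w (K :\: desc B1 v) - 4 * h) + 2 * h)); last first.
    have sub : desc B1 v \subset K.
      apply: subset_trans (desc_mono v sB1) _.
      by rewrite [K]EK; apply: desc_trans; rewrite -EK.
    have := wtD w sub; lia.
  rewrite leq_add2r; apply: excess_inside => K' cK' sK'.
  have [disj|] := boolP [disjoint K' & desc B1 v].
    by left; rewrite subsetD sK'.
  rewrite -setI_eq0 => /set0Pn[x /setIP[xK' xv]]; right.
  have [s' s'K' EK'] := component_sink cK'.
  have s'B2 := subsetP (components_sub cK') _ s'K'.
  have s'v : s' \in desc B1 v.
    have : s' \in component (B :\: [set s; v]) x.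
      by rewrite -(components_eq cK' xK').
    rewrite inE => /connect_closed; apply=> // a b.
    move=> /and3P[aB2 bB2 /orP[/eqP pab|/eqP pba]] aD.
      have nav : a != v by move: aB2; rewrite !inE negb_or; case/andP=> /andP[].
      by have := desc_arc aD nav; rewrite pab => /andP[].
    by apply: arc_desc aD; rewrite /link /arc /= !(subsetP sB2) // pba eqxx.
  have ns'v : s' != v by move: s'B2; rewrite !inE negb_or; case/andP=> /andP[].
  have v_s' : v \notin desc B1 s'.
    by apply: desc_acyclic s'v ns'v; rewrite // -EK.
  have s'Ks : s' \in K :\ s.
    rewrite !inE (subsetP sK') // andbT.
    by move: s'B2; rewrite !inE negb_or; case/andP=> /andP[].
  have smaller : #|desc B1 s'| < #|desc B1 v|.
    apply: proper_card; rewrite properE desc_trans //=.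
    by apply/subsetPn; exists v => //; rewrite inE connect0.
  have light : wt w (desc B1 s') < h.
    rewrite ltnNge; apply/negP => s'_heavy.
    by have := v_min s'; rewrite s'Ks s'_heavy leqNgt smaller => /(_ isT).
  apply: light_excess light.
  by apply: wt_sub; rewrite [K']EK'; exact: desc_mono.
- exists [set s]; first by rewrite cards1.
  apply: (@leq_trans ((2 * wt w set0 - 4 * h) + 2 * h)); last first.
    by have -> : wt w set0 = 0 by [rewrite /wt big_set0]; lia.
  rewrite leq_add2r; apply: excess_inside => K' cK' sK'; right.
  have [s' s'K' EK'] := component_sink cK'.
  have s'Ks : s' \in K :\ s.
    rewrite !inE (subsetP sK') // andbT.
    by have := subsetP (components_sub cK') _ s'K'; rewrite !inE; case/andP.
  have : ~~ (h <= wt w (desc B1 s')).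
    apply: contra none => le; apply/exists_inP; by exists s'.
  by rewrite -ltnNge; apply: light_excess; rewrite {1}EK'.
Qed.

End Components.

(** * Levels *)

Lemma geometric_sum t L : 256 <= t -> 128 * (\sum_(1 <= j < L.+1) t ^ (L - j)) <= t ^ L.
Proof.
move=> t_big; elim: L => [|L IH]; first by rewrite big_nil muln0.
rewrite big_nat_recl // subSS subn0.
have -> : \sum_(1 <= j < L.+1) t ^ (L.+1 - j.+1) = \sum_(1 <= j < L.+1) t ^ (L - j).
  by apply: eq_bigr => j _; rewrite subSS.
rewrite expnS mulnDr; apply: (@leq_trans (256 * t ^ L)); first by lia.
by rewrite leq_mul2r t_big orbT.
Qed.

(** A ball grows by a factor of at most 7 with each step away from its centre,
    while the weight falls by the factor [b]. *)
Lemma geometric_ball b j : 14 <= b ->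
  \sum_(k < j) b ^ (j - k) * 7 ^ k + 2 * 7 ^ j <= 2 * b ^ j.
Proof.
move=> b_big; elim: j => [|j IH]; first by rewrite big_ord0 !expn0.
have -> : \sum_(k < j.+1) b ^ (j.+1 - k) * 7 ^ k =
          b * (\sum_(k < j) b ^ (j - k) * 7 ^ k + 7 ^ j).
  rewrite big_ord_recr /= subSnn expn1 mulnDr big_distrr /=; congr (_ + _).
  by apply: eq_bigr => k _; rewrite subSn ?expnS ?mulnA // ltnW.
have : 14 * 7 ^ j <= b * 7 ^ j by rewrite leq_mul2r b_big orbT.
have : b * (\sum_(k < j) b ^ (j - k) * 7 ^ k + 2 * 7 ^ j) <= b * (2 * b ^ j).
  by rewrite leq_mul2l IH orbT.
rewrite !expnS !mulnDr; lia.
Qed.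

Section Levels.
Variables (V : finType) (p : bool -> V -> V) (t L : nat).
Hypothesis fibre : forall c v, #|[set u | p c u == v & u != v]| <= 2.
Hypothesis t_big : 256 <= t.
Hypothesis t_4 : 4 %| t.

Definition nbhd v : {set V} :=
  [set v; p true v; p false v] :|:
  ([set u | p true u == v & u != v] :|: [set u | p false u == v & u != v]).

Lemma card_nbhd v : #|nbhd v| <= 7.
Proof.
apply: (leq_trans (leq_card_setU _ _)); apply: (@leq_trans (3 + 4)) => //.
apply: leq_add; last first.
  by apply: (leq_trans (leq_card_setU _ _)); apply: (@leq_trans (2 + 2)); rewrite ?leq_add.
by apply: (leq_trans (leq_card_setU _ _)); rewrite cards1 addn1 ltnS cards2; case: (_ != _).
Qed.

Lemma nbhd_fwd c v : p c v \in nbhd v.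
Proof. by rewrite !inE; case: c; rewrite eqxx ?orbT. Qed.

Lemma nbhd_bwd c v : v \in nbhd (p c v).
Proof.
by rewrite !inE; have [->|_] /= := eqVneq v (p c v); case: c; rewrite ?eqxx ?orbT.
Qed.

Definition ball k (Y : {set V}) := iter k (fun S => \bigcup_(v in S) nbhd v) Y.

Lemma card_ball k Y : #|ball k Y| <= 7 ^ k * #|Y|.
Proof.
elim: k => [|k IH]; first by rewrite expn0 mul1n.
rewrite /ball iterS -/(ball k Y); set S := ball k Y in IH *.
apply: (@leq_trans (\sum_(v in S) #|nbhd v|)).
  elim/big_rec2: _ => [|v m A _ le]; first by rewrite cards0.
  by apply: (leq_trans (leq_card_setU _ _)); rewrite leq_add2l.
apply: (@leq_trans (\sum_(v in S) 7)); first by apply: leq_sum => v _; exact: card_nbhd.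
by rewrite sum_nat_const mulnC expnS -mulnA leq_mul2l IH.
Qed.

Lemma ball_nbhd k Y u v : v \in ball k Y -> u \in nbhd v -> u \in ball k.+1 Y.
Proof. by move=> vb uv; rewrite /ball iterS; apply/bigcupP; exists v. Qed.

Definition lipschitz (f : V -> nat) :=
  [forall v, forall c, (f v <= (f (p c v)).+1) && (f (p c v) <= (f v).+1)].

(** At level [j] there are [t ^ (4 * j)] times fewer places than at level 0, so a
    vertex of that level takes the room of so many. *)
Definition lweight (f : V -> nat) v := (t ^ 4) ^ f v.

Definition low (f : V -> nat) j : {set V} := [set v | f v < j].

(** The factor [t ^ (L - j)] balances the scales: a cut at level [j] gains about
    [t ^ (5 * j)] there, hence [t ^ (L + 4 * j)] in energy, which is what the
    weight of the vertices cut out costs in the first summand; the number 16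
    makes the gain prevail. *)
Definition energy (f : V -> nat) :=
  t ^ L * (\sum_v lweight f v) +
  16 * \sum_c \sum_(1 <= j < L.+1)
     t ^ (L - j) * excess (p c) (lweight f) (t ^ (5 * j)) (low f j).

(** To take [Y] out of the vertices of level less than [j], the levels around [Y]
    are raised as well, by 1 less for each step, lest they jump along [p]. *)
Definition raise (f : V -> nat) (Y : {set V}) j v :=
  maxn (f v) (\max_(k < j) (if v \in ball k Y then j - k else 0)).

Lemma raise_lipschitz f Y j : lipschitz f -> lipschitz (raise f Y j).
Proof.
move=> fL.
suff step u v : f v <= (f u).+1 -> u \in nbhd v -> raise f Y j v <= (raise f Y j u).+1.
  apply/forallP => v; apply/forallP => c; have /forallP/(_ c)/andP[le1 le2] := forallP fL v.
  by apply/andP; split; apply: step; rewrite // ?nbhd_fwd ?nbhd_bwd.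
move=> le uv; rewrite /raise geq_max; apply/andP; split.
  by apply: leq_trans le _; rewrite ltnS leq_maxl.
apply/bigmax_leqP => k _; case: ifP => // vk.
have [lt|] := ltnP k.+1 j; last by case: j k {uv} vk => [[]|j] // k vk /=; lia.
apply: (@leq_trans (j - k.+1).+1); first by lia.
rewrite ltnS leq_max; apply/orP; right.
by rewrite (bigD1 (Ordinal lt)) //= (ball_nbhd vk uv) leq_maxl.
Qed.

Lemma raise_ge f Y j v : f v <= raise f Y j v.
Proof. exact: leq_maxl. Qed.

Lemma raise_le f Y j v : f v <= L -> j <= L -> raise f Y j v <= L.
Proof.
move=> fL jL; rewrite /raise geq_max fL; apply/bigmax_leqP => k _.
by case: ifP => // _; apply: leq_trans jL; exact: leq_subr.
Qed.

Lemma low_raise f Y j : 0 < j -> low (raise f Y j) j = low f j :\: Y.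
Proof.
move=> j0; apply/setP => v; rewrite !inE /raise gtn_max andbC.
apply: andb_id2r => _; have [vY|vY] /= := boolP (v \in Y).
  apply/negbTE; rewrite -leqNgt (bigD1 (Ordinal j0)) //= vY subn0.
  exact: leq_maxl.
case: j j0 => // j _; rewrite ltnS; apply/bigmax_leqP => -[[|k] kj] _ /=.
  by rewrite (negPf vY).
by case: ifP => _ //; lia.
Qed.

Lemma low_raise_sub f Y j i : low (raise f Y j) i \subset low f i.
Proof.
apply/subsetP => v; rewrite !inE; apply: leq_ltn_trans; exact: raise_ge.
Qed.

Lemma lweight_raise f Y j v : lweight f v <= lweight (raise f Y j) v.
Proof. by rewrite leq_pexp2l ?raise_ge // expn_gt0; lia. Qed.

Lemma t4_big : 14 <= t ^ 4.
Proof.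
by apply: (@leq_trans (t ^ 1)); rewrite ?leq_pexp2l ?expn1 //; lia.
Qed.

Lemma raise_cost f (Y : {set V}) j : #|Y| <= 2 ->
  \sum_v (lweight (raise f Y j) v - lweight f v) <= 4 * (t ^ 4) ^ j.
Proof.
move=> Y2; set b := t ^ 4.
have b0 : 0 < b by rewrite expn_gt0; lia.
apply: (@leq_trans (\sum_v \sum_(k < j) (if v \in ball k Y then b ^ (j - k) else 0))).
  apply: leq_sum => v _; rewrite leq_subLR /lweight -/b /raise.
  have [le|lt] := leqP (\max_(k < j) (if v \in ball k Y then j - k else 0)) (f v).
    by rewrite leq_addr.
  have [k Ek] : {k : 'I_j | \max_(k < j) (if v \in ball k Y then j - k else 0) =
                  if v \in ball k Y then j - k else 0}.
    by apply: eq_bigmax; case: j lt => [|j] //; rewrite ?big_ord0 ?card_ord.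
  rewrite Ek in lt *; rewrite (bigD1 k) //=; case: ifP lt => // _ _.
  by rewrite addnCA leq_addr.
rewrite exchange_big /=.
apply: (@leq_trans (\sum_(k < j) b ^ (j - k) * (7 ^ k * 2))).
  apply: leq_sum => k _; rewrite -big_mkcond sum_nat_const mulnC leq_mul2l.
  by apply/orP; right; apply: leq_trans (card_ball k Y) _; rewrite leq_mul2l Y2 orbT.
have := geometric_ball j t4_big; rewrite -/b.
have -> : \sum_(k < j) b ^ (j - k) * (7 ^ k * 2) = 2 * \sum_(k < j) b ^ (j - k) * 7 ^ k.
  by rewrite big_distrr; apply: eq_bigr => k _ /=; rewrite mulnA mulnC.
lia.
Qed.

(** Cutting a heavy component reduces the excess at level [j] by half of
    [t ^ (5 * j)].  This exceeds the cost of [4 * t ^ (4 * j)], which is paid once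
    for the total weight and once for the excess at each scale in each graph. *)
Lemma energy_drop f c j K : 0 < j <= L ->
  K \in components (p c) (low f j) -> t ^ (5 * j) < wt (lweight f) K ->
  exists Y : {set V}, energy (raise f Y j) < energy f.
Proof.
case/andP=> j0 jL cK heavy; pose h := t ^ (5 * j) %/ 4.
have Eh : t ^ (5 * j) = 4 * h.
  by rewrite /h [RHS]mulnC divnK // dvdn_exp // muln_gt0.
rewrite Eh in heavy; have [Y Y2 cut] := excess_cut cK heavy; exists Y.
pose d := 4 * (t ^ 4) ^ j; have cost := raise_cost f j Y2; rewrite -/d in cost.
set w := lweight f; set w' := lweight (raise f Y j).
have w_w' v : w v <= w' v := lweight_raise f Y j v.
have sumW : \sum_v w' v <= \sum_v w v + d.
  rewrite -leq_subLR -sumnB; first exact: cost.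
  by move=> v _; exact: w_w'.
pose S := \sum_(1 <= i < L.+1) t ^ (L - i).
pose F g c' := \sum_(1 <= i < L.+1)
     t ^ (L - i) * excess (p c') (lweight g) (t ^ (5 * i)) (low g i).
have F_up c' : F (raise f Y j) c' <= F f c' + S * (2 * d).
  rewrite /F /S big_distrl -big_split /=; apply: leq_sum => i _.
  rewrite -mulnDr leq_mul2l; apply/orP; right.
  exact: excess_mono (low_raise_sub f Y j i) w_w' cost.
have F_c : F (raise f Y j) c + t ^ (L - j) * (2 * h) <= F f c + S * (2 * d).
  have splitS G : \sum_(1 <= i < L.+1) G i =
      \sum_(1 <= i < j) G i + (G j + \sum_(j.+1 <= i < L.+1) G i).
    by rewrite (@big_cat_nat _ _ _ j) ?leqW //= (@big_ltn _ _ _ j).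
  rewrite /F /S !splitS.
  set e' := excess (p c) w' _ (low (raise f Y j) j); set e := excess (p c) w _ (low f j).
  have le_e : e' + 2 * h <= e + 2 * d.
    apply: (@leq_trans (excess (p c) w (4 * h) (low f j :\: Y) + 2 * d + 2 * h)).
      rewrite leq_add2r /e' Eh low_raise //; exact: excess_mono.
    by rewrite addnAC leq_add2r /e Eh.
  have part (a b : nat) :
     \sum_(a <= i < b) t ^ (L - i) * excess (p c) w' (t ^ (5 * i)) (low (raise f Y j) i) <=
     \sum_(a <= i < b) t ^ (L - i) * excess (p c) w (t ^ (5 * i)) (low f i) +
     (\sum_(a <= i < b) t ^ (L - i)) * (2 * d).
    rewrite big_distrl -big_split /=; apply: leq_sum => i _.
    rewrite -mulnDr leq_mul2l; apply/orP; right.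
    exact: excess_mono (low_raise_sub f Y j i) w_w' cost.
  have := part 1 j; have := part j.+1 L.+1.
  have : t ^ (L - j) * (e' + 2 * h) <= t ^ (L - j) * (e + 2 * d).
    by rewrite leq_mul2l le_e orbT.
  rewrite !mulnDr !mulnDl.
  move: (t ^ (L - j) * _) (t ^ (L - j) * _) (t ^ (L - j) * (2 * d)) (t ^ (L - j) * (2 * h)).
  move=> x1 x2 x3 x4; do 6 move: (\sum_(_ <= _ < _) _) => ?; lia.
have F_sum : \sum_c' F (raise f Y j) c' + t ^ (L - j) * (2 * h) <=
             \sum_c' F f c' + 2 * (S * (2 * d)).
  rewrite !big_bool /=; have := F_up (~~ c); move: F_c; case: (c) => /=; lia.
have S_small : 128 * S <= t ^ L := geometric_sum L t_big.
have Ed : t ^ (L - j) * (4 * h) = t ^ L * (t ^ 4) ^ j.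
  rewrite -Eh -expnM -!expnD; congr (_ ^ _); lia.
rewrite /energy -/w -/w' -!/(F _ _).
have X0 : 0 < t ^ L * (t ^ 4) ^ j by rewrite muln_gt0 !expn_gt0; lia.
have : t ^ L * (\sum_v w' v) <= t ^ L * (\sum_v w v) + t ^ L * d.
  by rewrite -mulnDr leq_mul2l sumW orbT.
have : 128 * S * d <= t ^ L * d by rewrite leq_mul2r S_small orbT.
have Etd : t ^ L * d = 4 * (t ^ L * (t ^ 4) ^ j) by rewrite /d mulnCA.
have Eth : t ^ (L - j) * (4 * h) = 2 * (t ^ (L - j) * (2 * h)) by lia.
move: F_sum Ed; rewrite Eth.
have -> : \sum_c' F f c' = \sum_c' \sum_(1 <= i < L.+1)
     t ^ (L - i) * excess (p c') w (t ^ (5 * i)) (low f i) by [].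
have -> : \sum_c' F (raise f Y j) c' = \sum_c' \sum_(1 <= i < L.+1)
     t ^ (L - i) * excess (p c') w' (t ^ (5 * i)) (low (raise f Y j) i) by [].
have -> : 128 * S * d = 64 * (S * (2 * d)) by lia.
move: X0 Etd.
move: (\sum_(c' : bool) _) (\sum_(c' : bool) _) (S * (2 * d)) (t ^ L * d).
move: (t ^ L * (\sum_v w' v)) (t ^ L * (\sum_v w v)) (t ^ (L - j) * (2 * h)) (t ^ L * _ ^ j).
clear; lia.
Qed.

Lemma energy0 : energy (fun=> 0) <= t ^ L * (2 * #|V|).
Proof.
have S_small := geometric_sum L t_big; rewrite /energy.
have -> : \sum_v lweight (fun=> 0) v = #|V|.
  by rewrite -[RHS]sum1_card; apply: eq_bigr => v _; rewrite /lweight expn0.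
set S := \sum_(1 <= j < L.+1) _ in S_small.
apply: (@leq_trans (t ^ L * #|V| + 16 * \sum_(c : bool) S * (2 * #|V|))).
  rewrite leq_add2l leq_mul2l; apply/orP; right; apply: leq_sum => c _.
  rewrite /S big_distrl /=; apply: leq_sum => j _.
  rewrite leq_mul2l; apply/orP; right.
  apply: leq_trans (excess_disjoint (S := setT) _ _ (components_triv _ _) _) _.
    by move=> K _; exact: subsetT.
  apply: leq_trans (leq_subr _ _) _; rewrite leq_mul2l /= /wt -sum1_card.
  by rewrite (eq_bigl xpredT) => [|v]; rewrite ?inE // leq_sum.
rewrite big_bool /=.
have S_V : 128 * (S * #|V|) <= t ^ L * #|V|.
  by rewrite mulnA leq_mul2r S_small orbT.
have -> : S * (2 * #|V|) = 2 * (S * #|V|) by rewrite mulnCA.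
have -> : t ^ L * (2 * #|V|) = 2 * (t ^ L * #|V|) by rewrite mulnCA.
by move: S_V; move: (S * _) (t ^ L * _); clear; lia.
Qed.

(** Vertices are cut out of the two graphs at all scales at once.  A cut at
    level [j] is worth it as long as it splits a component of weight more than
    [t ^ (5 * j)]; since its own weight, and that of the vertices around it,
    is only of order [t ^ (4 * j)], a level function of minimal energy has both
    light components and a small total weight. *)
Lemma levels : exists f : V -> nat,
  [/\ forall v, f v <= L, lipschitz f,
      \sum_v lweight f v <= 2 * #|V| &
      forall c j K, 0 < j <= L -> K \in components (p c) (low f j) ->
        wt (lweight f) K <= t ^ (5 * j)].
Proof.
pose val_fun (f : {ffun V -> 'I_L.+1}) v : nat := f v.
pose f0 : {ffun V -> 'I_L.+1} := [ffun=> ord0].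
have f0E : val_fun f0 =1 fun=> 0 by move=> v; rewrite /val_fun ffunE.
have lip_ext f g : f =1 g -> lipschitz f = lipschitz g.
  by move=> E; apply: eq_forallb => v; apply: eq_forallb => c; rewrite !E.
have en_ext f g : f =1 g -> energy f = energy g.
  move=> E; rewrite /energy.
  have Ew : lweight f =1 lweight g by move=> v; rewrite /lweight E.
  have El j : low f j = low g j by apply/setP => v; rewrite !inE E.
  congr (_ * _ + 16 * _); first exact: eq_bigr.
  apply: eq_bigr => c _; apply: eq_bigr => j _; rewrite El; congr (_ * _).
  by apply: eq_bigr => K _; rewrite /wt; under eq_bigr do rewrite Ew.
have f0L : lipschitz (val_fun f0).
  by rewrite (lip_ext _ _ f0E); apply/forallP => v; apply/forallP => c.
case: (@arg_minnP _ f0 (fun f => lipschitz (val_fun f)) (fun f => energy (val_fun f)) f0L).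
move=> f fL f_min; exists (val_fun f); split=> //.
- by move=> v; exact: (ltn_ord (f v)).
- have t0 : 0 < t ^ L by rewrite expn_gt0; lia.
  rewrite -(leq_pmul2l t0); apply: (@leq_trans (energy (val_fun f))).
    exact: leq_addr.
  by apply: leq_trans (f_min _ f0L) _; rewrite (en_ext _ _ f0E) energy0.
- move=> c j K jL cK; rewrite leqNgt; apply/negP => heavy.
  have [Y drop] := energy_drop jL cK heavy.
  pose g : {ffun V -> 'I_L.+1} := [ffun v => inord (raise (val_fun f) Y j v)].
  have gE : val_fun g =1 raise (val_fun f) Y j.
    move=> v; rewrite /val_fun ffunE inordK // ltnS raise_le //; last by case/andP: jL.
    exact: (ltn_ord (f v)).
  have gL : lipschitz (val_fun g) by rewrite (lip_ext _ _ gE) raise_lipschitz.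
  by have := f_min g gL; rewrite (en_ext _ _ gE) leqNgt drop.
Qed.

End Levels.

(** * Balanced splitting *)

Section BeckFiala.
Import Order.TTheory GRing.Theory Num.Theory.
Local Open Scope ring_scope.

(** There are fewer equations than free coordinates. *)
Lemma kernel_direction (I R : finType) (F : {set I}) (S : {set R})
    (A : R -> I -> rat) :
  (#|S| < #|F|)%N ->
  exists z : I -> rat,
    [/\ forall i, i \notin F -> z i = 0, exists i, z i != 0 &
        forall r, r \in S -> \sum_i A r i * z i = 0].
Proof.
move=> ltSF; pose M : 'M[rat]_(#|F|, #|S|) := \matrix_(k, l) A (enum_val l) (enum_val k).
have : kermx M != 0.
  rewrite kermx_eq0 /row_free; apply/eqP => Er.
  by move: (rank_leq_col M); rewrite Er leqNgt ltSF.
rewrite -nz_row_eq0; set u := nz_row _ => u0.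
have uM : u *m M = 0 by apply/sub_kermxP; exact: nz_row_sub.
pose z i := \sum_(k < #|F|) (enum_val k == i)%:R * u 0 k.
have z_val k : z (enum_val k) = u 0 k.
  rewrite /z (bigD1 k) //= eqxx mul1r big1 ?addr0 // => l lk.
  by rewrite (inj_eq enum_val_inj) (negPf lk) mul0r.
exists z; split.
- move=> i iF; apply: big1 => k _; case: eqP => [Ei|]; last by rewrite mul0r.
  by move: iF; rewrite -Ei enum_valP.
- case: (altP (@existsP _ (fun k => u 0 k != 0))) => [[k uk]|].
    by exists (enum_val k); rewrite z_val.
  rewrite negb_exists => /forallP u_0; case/eqP: u0; apply/rowP => k.
  by rewrite mxE; apply/eqP; rewrite -[_ == _]negbK u_0.
- move=> r rS; transitivity ((u *m M) 0 (enum_rank_in rS r)); last by rewrite uM mxE.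
  rewrite mxE; under eq_bigr do rewrite big_distrr /=.
  rewrite exchange_big /=; apply: eq_bigr => k _; rewrite mxE enum_rankK_in //.
  rewrite (bigD1 (enum_val k)) //= eqxx mul1r big1 ?addr0 ?(mulrC (A _ _)) // => i ik.
  by rewrite eq_sym (negPf ik) mul0r mulr0.
Qed.

(** The Beck-Fiala theorem.  Only rows of mass more than [s] on the fractional
    coordinates have to be kept exact; there are fewer of them than fractional
    coordinates, which leaves a direction in which to move until one more
    coordinate is integral. *)
Lemma beck_fiala (I R : finType) (A : R -> I -> rat) (s : rat) (x : I -> rat) :
  0 <= s -> (forall r i, 0 <= A r i) -> (forall i, \sum_r A r i <= s) ->
  (forall i, 0 <= x i <= 1) ->
  exists y : I -> rat,
    [/\ forall i, (y i == 0) || (y i == 1),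
        forall i, (x i == 0) || (x i == 1) -> y i = x i &
        forall r, `| \sum_i A r i * (y i - x i) | <= s].
Proof.
move=> s0 A0 As; pose F x := [set i : I | (x i != 0) && (x i != 1 :> rat)].
have [n] := ubnP #|F x|; elim: n x => // n IH x; rewrite ltnS => leF x01.
have Fin (i : I) (x1 : I -> rat) : (i \in F x1) = ~~ ((x1 i == 0) || (x1 i == 1)).
  by rewrite inE negb_or.
have [F0|/set0Pn[i1 i1F]] := eqVneq (F x) set0.
  have xint i : (x i == 0) || (x i == 1) by rewrite -[_ || _]negbK -Fin F0 inE.
  exists x; split=> // r; rewrite big1 ?normr0 => [|i _]; last by rewrite subrr mulr0.
  by [].
pose S := [set r | s < \sum_(i in F x) A r i].
have ltSF : (#|S| < #|F x|)%N.
  have [S0|/set0Pn[r1 r1S]] := eqVneq S set0.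
    by rewrite S0 cards0; apply/card_gt0P; exists i1.
  have : s *+ #|S| < s *+ #|F x|.
    apply: (@lt_le_trans _ _ (\sum_(r in S) \sum_(i in F x) A r i)).
      rewrite -sumr_const; apply: ltr_sum => [|r]; last by rewrite inE.
      by apply/hasP; exists r1; rewrite ?mem_index_enum.
    rewrite exchange_big /= -sumr_const; apply: ler_sum => i _.
    apply: le_trans (As i); rewrite [leRHS](bigID (mem S)) /= lerDl.
    exact: sumr_ge0.
  by rewrite ltnNge; apply: contraTN => le; rewrite -leNgt ler_wpMn2l.
have [z [zF [i2 zi2] zS]] := kernel_direction A ltSF.
pose room i := if 0 < z i then (1 - x i) / z i else x i / - z i.
case: (@arg_minP _ _ _ i2 (fun i => z i != 0) room zi2) => i0 zi0 i0_min.
pose x' i := x i + room i0 * z i.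
have zFin i : z i != 0 -> i \in F x.
  by apply: contraNT => iF; rewrite zF.
have room0 : 0 <= room i0.
  have /andP[x0 x1] := x01 i0; rewrite /room; case: ltP => zz.
    by rewrite divr_ge0 ?subr_ge0 // ltW.
  by rewrite divr_ge0 // oppr_ge0.
have x'01 i : 0 <= x' i <= 1.
  have /andP[x0 x1] := x01 i.
  have [z0|znz] := eqVneq (z i) 0; first by rewrite /x' z0 mulr0 addr0 x0.
  have le := i0_min i znz; rewrite /room in le; rewrite -/(room i0) in le.
  case: (ltrP 0 (z i)) le => zz le.
    rewrite /x' addr_ge0 ?(mulr_ge0 room0 (ltW zz)) //=.
    by rewrite -lerBrDl -ler_pdivlMr.
  have zneg : 0 < - z i by rewrite oppr_gt0 lt_neqAle znz.
  rewrite /x'; apply/andP; split.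
    by move: le; rewrite ler_pdivlMr // mulrN; lra.
  apply: le_trans x1; rewrite gerDl; apply: mulr_ge0_le0 => //.
have x'i0 : i0 \notin F x'.
  rewrite Fin negbK /x' /room; case: ltP => zz.
    by rewrite divfK // addrC subrK eqxx orbT.
  by rewrite invrN mulrN mulNr divfK // subrr eqxx.
have subF : F x' \proper F x.
  apply/properP; split; last by exists i0; rewrite // zFin.
  apply/subsetP => i; rewrite !Fin; apply: contra => xint.
  have iF : i \notin F x by rewrite Fin negbK.
  by rewrite /x' zF // mulr0 addr0.
have [|y [yint yx' yr]] := IH x' _ x'01.
  by apply: leq_trans leF; exact: proper_card.
have yx i : (x i == 0) || (x i == 1) -> y i = x i.
  move=> xint; have iF : i \notin F x by rewrite Fin negbK.
  by rewrite yx' /x' zF // mulr0 addr0.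
exists y; split=> // r; have [rS|] := boolP (r \in S).
  have -> : \sum_i A r i * (y i - x i) = \sum_i A r i * (y i - x' i).
    rewrite -[RHS]addr0 -[X in _ + X](mulr0 (room i0)) -[X in _ * X](zS r rS).
    rewrite big_distrr -big_split /=; apply: eq_bigr => i _; rewrite /x'; lra.
  exact: yr.
rewrite inE -leNgt; apply: le_trans.
rewrite (bigID (mem (F x))) /= [X in _ + X]big1 ?addr0; last first.
  by move=> i; rewrite Fin negbK => /yx ->; rewrite subrr mulr0.
apply: le_trans (ler_norm_sum _ _ _) _; apply: ler_sum => i _.
rewrite normrM ger0_norm // -[leRHS]mulr1; apply: ler_wpM2l => //.
have /andP[x0 x1] := x01 i; rewrite ler_norml.
by case/orP: (yint i) => /eqP ->; lra.
Qed.

Local Close Scope ring_scope.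

(** The vertices come in items, which must not be split, and in rows, in each of
    which the weight is to be halved. *)
Lemma split_bit (V I R : finType) (item : V -> I) (row : V -> R)
    (w : V -> nat) (s : nat) :
  (forall i, \sum_(v | item v == i) w v <= s) ->
  exists side : I -> bool, forall r b,
    2 * (\sum_(v | (row v == r) && (side (item v) == b)) w v)
      <= \sum_(v | row v == r) w v + 2 * s.
Proof.
move=> item_s.
pose a r i := \sum_(v | (row v == r) && (item v == i)) w v.
have a_s i : \sum_r a r i <= s.
  apply: leq_trans (item_s i); rewrite [leqRHS](partition_big row xpredT) //=.
  by apply: leq_sum => r _; rewrite /a (eq_bigl _ _ (fun v => andbC _ _)).
have [||||y [yint _ yr]] := @beck_fiala I R (fun r i => (a r i)%:R%R) s%:R%R (fun=> (1/2%:R)%R).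
- exact: ler0n.
- by move=> r i; exact: ler0n.
- by move=> i; rewrite -natr_sum ler_nat.
- by move=> i; lra.
exists (fun i => y i == 1%R) => r b.
pose half (c : bool) := \sum_(v | (row v == r) && ((y (item v) == 1%R) == c)) w v.
have total : \sum_(v | row v == r) w v = half true + half false.
  rewrite (bigID (fun v => y (item v) == 1%R)) /=; congr (_ + _); apply: eq_bigl => v.
    by rewrite eqb_id.
  by rewrite eqbF_neg.
have a_half c : half c = \sum_(i | (y i == 1%R) == c) a r i.
  rewrite /half (partition_big item (fun i => (y i == 1%R) == c)) => [|v /andP[]//] /=.
  apply: eq_bigr => i yi; rewrite /a; apply: eq_bigl => v; rewrite -andbA; congr andb.
  by have [->|_] := eqVneq (item v) i; rewrite ?yi ?andbF.
have dev : (\sum_i (a r i)%:R * (y i - 1 / 2%:R) =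
            ((half true)%:R - (half false)%:R) / 2%:R :> rat)%R.
  rewrite (bigID (fun i => y i == 1%R)) /= !a_half !natr_sum mulrBl !mulr_suml -sumrN.
  congr (_ + _)%R; first by apply: eq_big => [i|i /eqP ->]; [rewrite eqb_id|lra].
  apply: eq_big => [i|i yi1]; first by rewrite eqbF_neg.
  by have := yint i; rewrite (negPf yi1) orbF => /eqP ->; lra.
have := yr r; rewrite dev ler_norml total => /andP[].
rewrite -/(half b) => le1 le2; rewrite -(ler_nat rat) !natrD.
by case: b; lra.
Qed.

End BeckFiala.

(** The sums are halved [q] times; the errors add up to a geometric series, hence
    a total error that does not grow with [q]. *)
Lemma split_class (V I R : finType) (item : V -> I) (row : V -> R)
    (w : V -> nat) (s q : nat) :
  (forall i, \sum_(v | item v == i) w v <= s) ->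
  exists digit : I -> nat, (forall i, digit i < 2 ^ q) /\
    forall r d,
    2 ^ q * (\sum_(v | (row v == r) && (digit (item v) == d)) w v)
      <= \sum_(v | row v == r) w v + 2 ^ q * (2 * s).
Proof.
move=> item_s.
(* The additional [2 * s] is what remains of the geometric series. *)
suff [code codeP] : exists code : I -> q.-tuple bool, forall r d,
    2 ^ q * (\sum_(v | (row v == r) && (code (item v) == d)) w v) + 2 * s
      <= \sum_(v | row v == r) w v + 2 ^ q * (2 * s).
  have card : #|{: q.-tuple bool}| = 2 ^ q by rewrite card_tuple card_bool.
  exists (fun i => enum_rank (code i) : nat); split=> [i|r d].
    by rewrite -card ltn_ord.
  have [lt|ge] := ltnP d (2 ^ q); last first.
    rewrite big_pred0 ?muln0 // => v; apply/negP => /andP[_ /eqP Ed].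
    by move: ge; rewrite -Ed -card leqNgt ltn_ord.
  rewrite -card in lt; apply: leq_trans (leq_addr (2 * s) _) _.
  apply: leq_trans (codeP r (enum_val (Ordinal lt))).
  rewrite leq_add2r leq_mul2l; apply/orP; right; apply: eq_leq; apply: eq_bigl => v.
  congr andb; apply/eqP/eqP => [Ed|->]; last by rewrite enum_valK.
  by rewrite (_ : Ordinal lt = enum_rank (code (item v))) ?enum_rankK //; apply: val_inj.
elim: q => [|q [code codeP]].
  exists (fun=> [tuple]) => r d; rewrite !mul1n leq_add2r.
  by rewrite big_mkcondr /=; apply: leq_sum => v _; case: ifP.
have [side sideP] := split_bit (fun v => (row v, code (item v))) item_s.
exists (fun i => [tuple of side i :: code i]) => r d.
case/tupleP: d => b d.
have := sideP (r, d) b; have := codeP r d.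
have -> : \sum_(v | (row v, code (item v)) == (r, d)) w v =
          \sum_(v | (row v == r) && (code (item v) == d)) w v by [].
have -> : \sum_(v | ((row v, code (item v)) == (r, d)) && (side (item v) == b)) w v =
          \sum_(v | (row v == r) &&
             ([tuple of side (item v) :: code (item v)] == [tuple of b :: d])) w v.
  apply: eq_bigl => v; rewrite xpair_eqE -andbA; congr andb.
  by rewrite andbC -!val_eqE /= eqseq_cons.
rewrite expnS -!mulnA.
set y := \sum_(v | (row v == r) && (code (item v) == d)) w v.
set z := \sum_(v | (row v == r) && (_ == [tuple of b :: d])) w v => le1 le2.
have : 2 ^ q * (2 * z) <= 2 ^ q * (y + 2 * s) by rewrite leq_mul2l le2 orbT.
by rewrite mulnDr [2 ^ q * (2 * z)]mulnCA; lia.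
Qed.

(** * Nested blocks *)

Section Blocks.
Variables (V : finType) (p : bool -> V -> V) (t L : nat) (lev : V -> nat).
Hypothesis tE : t = 2 ^ 8.
Local Notation w := (lweight t lev).
Local Notation Q := (t ^ 3).
Hypothesis total : \sum_v w v <= 2 * t ^ (6 * L).
Hypothesis light : forall c j K, 0 < j <= L -> K \in components (p c) (low lev j) ->
  wt w K <= t ^ (5 * j).

Let t_ge2 : 2 <= t. Proof. by rewrite tE. Qed.

Let t_gt0 : 0 < t. Proof. by rewrite tE. Qed.

Definition load_bound i := 2 * t ^ (6 * i) + 8 * t ^ (5 * i + 5).

(** [a v] and [b v] are the blocks of [v] at scale [i]; they matter for the
    vertices of level at most [i]. *)
Definition good_blocks i (a b : V -> nat) :=
  [/\ forall v, a v < Q ^ (L - i) /\ b v < Q ^ (L - i),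
      forall v, lev v <= i -> lev (p true v) <= i -> a (p true v) = a v,
      forall v, lev v <= i -> lev (p false v) <= i -> b (p false v) = b v &
      forall x y, \sum_(v | (lev v <= i) && ((a v == x) && (b v == y))) w v
                  <= load_bound i].

(** One step of [split_class], into [t ^ 3 = 2 ^ 24] classes; the items are the
    components of the vertices of low level, so that [p c] does not leave the
    class. *)
Lemma split_components c j (R : finType) (row : V -> R) : j < L ->
  exists d : V -> nat,
    [/\ forall v, d v < Q,
        forall v, lev v <= j -> lev (p c v) <= j -> d (p c v) = d v &
        forall r k,
          Q * (\sum_(v | (lev v <= j) && ((row v == r) && (d v == k))) w v)
          <= \sum_(v | (lev v <= j) && (row v == r)) w v + Q * (2 * t ^ (5 * j.+1))].
Proof.
move=> jL; set B := low lev j.+1; pose item v := component (p c) B v.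
pose wB v := if lev v <= j then w v else 0.
have item_s K : \sum_(v | item v == K) wB v <= t ^ (5 * j.+1).
  rewrite -big_mkcondr /=.
  have [K0|cK] := boolP (K \in components (p c) B); last first.
    rewrite big_pred0 // => v; apply/negP => /andP[/eqP Ev vj].
    by case/negP: cK; rewrite -Ev; apply: imset_f; rewrite inE ltnS.
  apply: leq_trans (light (c := c) _ K0); last by [].
  rewrite /wt big_mkcond [leqRHS]big_mkcond /=; apply: leq_sum => v _.
  by case: andP => // -[/eqP <- _]; rewrite mem_component.
have [dig [dig_lt digP]] := split_class row 24 item_s.
have EQ : Q = 2 ^ 24 by rewrite tE -expnM.
exists (fun v => dig (item v)); split=> [v|v vj pvj|r k].
- by rewrite EQ.
- congr dig; apply: component_eq; rewrite inE; apply: connect1.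
  by rewrite /link /= !inE !ltnS vj pvj eqxx.
have := digP r k; rewrite -EQ.
rewrite -!big_mkcondr /=.
by under eq_bigl do rewrite andbC; under [X in _ <= X + _]eq_bigl do rewrite andbC.
Qed.

(** The blocks of the first kind are split first, evenly in each intersection of
    two old blocks; then those of the second kind, evenly in each intersection
    of an old block with a new one. *)
Lemma refine_blocks j a b : j < L -> good_blocks j.+1 a b ->
  exists a' b', [/\ forall v, a' v %/ Q = a v, forall v, b' v %/ Q = b v &
                    good_blocks j a' b'].
Proof.
move=> jL [range a_const b_const load].
have Q0 : 0 < Q by rewrite expn_gt0 t_gt0.
have EL : Q ^ (L - j) = Q ^ (L - j.+1) * Q by rewrite -expnSr subnSK.
pose row v := (Ordinal (range v).1, Ordinal (range v).2).
have [d [d_lt d_const d_load]] := split_components true row jL.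
pose a' v := a v * Q + d v.
have a'_lt v : a' v < Q ^ (L - j).
  rewrite EL; apply: (@leq_trans ((a v).+1 * Q)); first by rewrite /a' mulSn addnC ltn_add2r.
  by rewrite leq_mul2r (range v).1 orbT.
have a'_div v : a' v %/ Q = a v by rewrite divnMDl // divn_small ?addn0.
have a'_mod v : a' v %% Q = d v by rewrite modnMDl modn_small.
pose row' v := (Ordinal (a'_lt v), Ordinal (range v).2).
have [e [e_lt e_const e_load]] := split_components false row' jL.
pose b' v := b v * Q + e v.
have b'_div v : b' v %/ Q = b v by rewrite divnMDl // divn_small ?addn0.
have b'_mod v : b' v %% Q = e v by rewrite modnMDl modn_small.
exists a', b'; split=> //; split.
- move=> v; split=> //; rewrite EL.
  apply: (@leq_trans ((b v).+1 * Q)); first by rewrite /b' mulSn addnC ltn_add2r.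
  by rewrite leq_mul2r (range v).2 orbT.
- by move=> v vj pvj; rewrite /a' a_const ?d_const ?leqW.
- by move=> v vj pvj; rewrite /b' b_const ?e_const ?leqW.
move=> x y; set s := t ^ (5 * j.+1) in d_load e_load.
set load' := \sum_(v | _) _.
have [v0 v0P|none] := pickP (fun v => (lev v <= j) && ((a' v == x) && (b' v == y))); last first.
  by rewrite /load' big_pred0.
have /and3P[_ /eqP Ex /eqP Ey] := v0P.
have le_e : Q * load' <= \sum_(v | (lev v <= j) && (row' v == row' v0)) w v + Q * (2 * s).
  apply: leq_trans (e_load (row' v0) (e v0)); rewrite leq_mul2l; apply/orP; right.
  apply: eq_leq; apply: eq_bigl => v; congr andb.
  rewrite xpair_eqE -!val_eqE /= -Ex -andbA; congr andb.
  apply/eqP/andP => [Eb|[/eqP Eb /eqP Ee]]; last by rewrite -Ey /b' Eb Ee.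
  by rewrite -!b'_div -!b'_mod Eb Ey.
have le_d : Q * (\sum_(v | (lev v <= j) && (row' v == row' v0)) w v) <=
            load_bound j.+1 + Q * (2 * s).
  apply: leq_trans (leq_trans _ (d_load (row v0) (d v0))) _.
    rewrite leq_mul2l; apply/orP; right.
    apply: eq_leq; apply: eq_bigl => v; congr andb.
    rewrite !xpair_eqE -!val_eqE /= andbAC; congr andb.
    apply/eqP/andP => [Ea|[/eqP Ea /eqP Ed]]; last by rewrite /a' Ea Ed.
    by rewrite -!a'_div -!a'_mod Ea.
  rewrite leq_add2r; apply: leq_trans (load (a v0) (b v0)).
  rewrite big_mkcond [leqRHS]big_mkcond /=; apply: leq_sum => v _.
  rewrite xpair_eqE -!val_eqE /=; case: (leqP (lev v) j) => // vj.
  by rewrite leqW.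
have Q2 : t ^ 6 = Q * Q by rewrite -expnD.
rewrite -(@leq_pmul2l (t ^ 6)) ?expn_gt0 ?t_gt0 //.
have {}le_e : Q * Q * load' <=
   Q * (\sum_(v | (lev v <= j) && (row' v == row' v0)) w v) + Q * (Q * (2 * s)).
  by rewrite -mulnA -mulnDr leq_mul2l le_e orbT.
have Qs : Q * (2 * s) <= Q * (Q * (2 * s)) by rewrite leq_mul2l leq_pmull ?orbT.
have EQs : Q * (Q * (2 * s)) = 2 * t ^ (5 * j + 11).
  by rewrite mulnA -Q2 mulnCA /s -expnD; congr (2 * _ ^ _); lia.
have Et1 : t ^ 6 * load_bound j = 2 * t ^ (6 * j.+1) + 8 * t ^ (5 * j + 11).
  rewrite mulnDr !(mulnCA (t ^ 6)) -!expnD; congr (2 * t ^ _ + 8 * t ^ _); lia.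
have Et2 : load_bound j.+1 = 2 * t ^ (6 * j.+1) + 8 * t ^ (5 * j + 10).
  by congr (_ + 8 * t ^ _); lia.
have Et3 : 2 * t ^ (5 * j + 10) <= t ^ (5 * j + 11).
  by rewrite [5 * j + 11]addnS expnS leq_mul2r t_ge2 orbT.
by move: le_e le_d Qs; rewrite Et1 Et2 Q2 EQs; lia.
Qed.

Lemma eq_good_blocks i a b a' b' : a =1 a' -> b =1 b' ->
  good_blocks i a b -> good_blocks i a' b'.
Proof.
move=> Ea Eb [range a_const b_const load]; split=> [v|v|v|x y]; rewrite -?Ea -?Eb //.
- exact: a_const.
- exact: b_const.
by under eq_bigl do rewrite -Ea -Eb.
Qed.

(** At the top scale all vertices are in one block of each kind; each further
    scale splits the blocks evenly, up to the weight of a component. *)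
Lemma nested_blocks : (forall v, lev v <= L) ->
  exists a b : V -> nat, forall i, i <= L ->
    good_blocks i (fun v => a v %/ Q ^ i) (fun v => b v %/ Q ^ i).
Proof.
move=> lev_L.
suff down j : j <= L -> exists a b : V -> nat, forall i, j <= i <= L ->
    good_blocks i (fun v => a v %/ Q ^ (i - j)) (fun v => b v %/ Q ^ (i - j)).
  have [a [b ab]] := down 0 (leq0n L); exists a, b => i iL.
  by have := ab i; rewrite leq0n iL subn0; apply.
move=> jL; rewrite -(subKn jL); elim: {j jL}(L - j) (leq_subr j L) => [_|k IH kL].
  rewrite subn0; exists (fun=> 0), (fun=> 0) => i; rewrite -eqn_leq => /eqP <-.
  split=> [v|v _ _|v _ _|x y]; rewrite ?div0n //.
    by rewrite subnn.
  apply: (@leq_trans (\sum_v w v)); last exact: leq_trans total (leq_addr _ _).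
  by rewrite [leqLHS]big_mkcond /=; apply: leq_sum => v _; case: ifP.
have [a [b ab]] := IH (ltnW kL); set j := L - k.+1.
have Ej : L - k = j.+1 by rewrite /j -subnSK.
have jL : j < L by rewrite /j ltn_subrL (leq_trans _ kL).
rewrite Ej in ab; have good_j : good_blocks j.+1 a b.
  have := ab j.+1; rewrite leqnn jL subnn expn0 => /(_ isT).
  by apply: eq_good_blocks => v; rewrite divn1.
have [a' [b' [a'_div b'_div good']]] := refine_blocks jL good_j.
exists a', b' => i /andP[ji iL].
have [<-|nij] := eqVneq j i.
  by apply: eq_good_blocks good' => v; rewrite subnn divn1.
have lt_ji : j < i by rewrite ltn_neqAle nij.
have Ea v : a' v %/ Q ^ (i - j) = a v %/ Q ^ (i - j.+1).
  by rewrite -subnSK // expnS divnMA a'_div.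
have Eb v : b' v %/ Q ^ (i - j) = b v %/ Q ^ (i - j.+1).
  by rewrite -subnSK // expnS divnMA b'_div.
by apply: eq_good_blocks (ab i _) => [v|v|]; rewrite ?Ea ?Eb ?lt_ji.
Qed.

End Blocks.

(** * Labels *)

(** A vertex of the universal hypergraph stands for a level [j], a block of each
    of the two kinds at scale [j], and one of [cap t j] places in the
    intersection of these blocks.  The vertices of level [j] are numbered from
    [size_at t L j] to [2 * size_at t L j - 1]; these intervals are disjoint,
    as [size_at] decreases quickly with [j]. *)
Definition cap t j := 10 * t ^ (2 * j + 5).
Definition width t L j := t ^ (3 * (L - j)).
Definition size_at t L j := width t L j * width t L j * cap t j.
Definition label t L j a b k :=
  size_at t L j + ((a * width t L j + b) * cap t j + k).

Definition level t L x := \sum_(j < L) (x < size_at t L j).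
Definition block1 t L x :=
  (x - size_at t L (level t L x)) %/ (width t L (level t L x) * cap t (level t L x)).
Definition block2 t L x :=
  ((x - size_at t L (level t L x)) %/ cap t (level t L x)) %% width t L (level t L x).
Definition is_label t L x :=
  (size_at t L (level t L x) <= x) && (x < 2 * size_at t L (level t L x)).

(** Block [b] of level [l] lies in block [b %/ t ^ 3] of level [l.+1]. *)
Definition near t (lx bx ly by_ : nat) :=
  [|| (lx == ly) && (bx == by_), (ly == lx.+1) && (by_ == bx %/ t ^ 3)
    | (lx == ly.+1) && (bx == by_ %/ t ^ 3)].
Definition near1 t L x y := near t (level t L x) (block1 t L x) (level t L y) (block1 t L y).
Definition near2 t L x y := near t (level t L x) (block2 t L x) (level t L y) (block2 t L y).

Section Labels.
Variables (t L : nat).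
Hypothesis t_ge2 : 2 <= t.

Lemma texp_gt0 n : 0 < t ^ n.
Proof. by rewrite expn_gt0; case: t t_ge2. Qed.

Lemma cap_gt0 j : 0 < cap t j.
Proof. by rewrite muln_gt0 texp_gt0. Qed.

Lemma width_gt0 j : 0 < width t L j.
Proof. exact: texp_gt0. Qed.

Lemma size_atE j : size_at t L j = 10 * t ^ (6 * (L - j) + (2 * j + 5)).
Proof.
rewrite /size_at /width /cap mulnCA -!expnD; congr (10 * t ^ _); lia.
Qed.

Lemma size_at_lt i j : i < j -> j <= L -> 2 * size_at t L j <= size_at t L i.
Proof.
move=> ij jL; rewrite !size_atE mulnCA leq_mul2l /=.
apply: (@leq_trans (t * t ^ (6 * (L - j) + (2 * j + 5)))); first by rewrite leq_mul2r t_ge2 orbT.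
by rewrite -expnS leq_pexp2l; lia.
Qed.

Lemma level_le x : level t L x <= L.
Proof.
apply: (@leq_trans (\sum_(j < L) 1)); first by apply: leq_sum => j _; exact: leq_b1.
by rewrite sum1_card card_ord.
Qed.

Lemma levelE x j : j <= L -> size_at t L j <= x < 2 * size_at t L j -> level t L x = j.
Proof.
move=> jL /andP[ge lt]; rewrite /level.
rewrite (eq_bigr (fun i : 'I_L => (i < j) : nat)) => [|i _]; last first.
  congr nat_of_bool; have [ij|ji] := ltnP i j.
    exact: leq_trans lt (size_at_lt ij jL).
  apply/negbTE; rewrite -leqNgt; apply: leq_trans ge.
  have [->//|nij] := eqVneq (j : nat) i.
  apply: (@leq_trans (2 * size_at t L i)); first exact: leq_pmull.
  apply: size_at_lt; last exact: ltnW (ltn_ord i).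
  by rewrite ltn_neqAle nij.
rewrite -(big_mkord xpredT (fun i => (i < j) : nat)) (@big_cat_nat _ _ _ j) //=.
rewrite (eq_big_nat _ _ (F2 := fun=> 1)) => [|i /andP[_ ->]//].
rewrite [X in _ + X](eq_big_nat _ _ (F2 := fun=> 0)) => [|i /andP[ji _]].
  by rewrite sum_nat_const_nat subn0 muln1 big1 ?addn0.
by rewrite ltnNge ji.
Qed.

Section Label.
Variables (j a b k : nat).
Hypotheses (jL : j <= L) (aw : a < width t L j) (bw : b < width t L j) (kc : k < cap t j).

Lemma label_off : label t L j a b k - size_at t L j = (a * width t L j + b) * cap t j + k.
Proof. by rewrite /label addKn. Qed.

Lemma label_bounds : size_at t L j <= label t L j a b k < 2 * size_at t L j.
Proof.
rewrite leq_addr mul2n -addnn ltn_add2l /=.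
apply: (@leq_trans ((a * width t L j + b).+1 * cap t j)).
  by rewrite mulSn addnC ltn_add2r.
rewrite leq_mul2r; apply/orP; right.
apply: (@leq_trans (a.+1 * width t L j)); first by rewrite mulSn addnC ltn_add2r.
by rewrite leq_mul2r aw orbT.
Qed.

Lemma level_label : level t L (label t L j a b k) = j.
Proof. exact: levelE jL label_bounds. Qed.

Lemma is_label_label : is_label t L (label t L j a b k).
Proof. by rewrite /is_label level_label label_bounds. Qed.

Lemma block1_label : block1 t L (label t L j a b k) = a.
Proof.
rewrite /block1 level_label label_off [width t L j * _]mulnC divnMA divnMDl ?cap_gt0 //.
by rewrite (divn_small kc) addn0 divnMDl ?width_gt0 // (divn_small bw) addn0.
Qed.

Lemma block2_label : block2 t L (label t L j a b k) = b.
Proof.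
rewrite /block2 level_label label_off divnMDl ?cap_gt0 //.
by rewrite (divn_small kc) addn0 modnMDl modn_small.
Qed.

Lemma place_label : (label t L j a b k - size_at t L j) %% cap t j = k.
Proof. by rewrite label_off modnMDl modn_small. Qed.

End Label.

Lemma label_coord x : is_label t L x ->
  let j := level t L x in
  let k := (x - size_at t L j) %% cap t j in
  [/\ block1 t L x < width t L j, block2 t L x < width t L j, k < cap t j &
      x = label t L j (block1 t L x) (block2 t L x) k].
Proof.
case/andP=> ge lt /=; rewrite /block1 /block2; set j := level t L x in ge lt *.
split; last 1 first.
- rewrite /label [width t L j * cap t j]mulnC divnMA -divn_eq -divn_eq.
  by rewrite subnKC.
- rewrite ltn_divLR; last by rewrite muln_gt0 width_gt0 cap_gt0.
  by rewrite mulnA ltn_subLR // addnn -mul2n.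
- by rewrite ltn_mod width_gt0.
- by rewrite ltn_mod cap_gt0.
Qed.

Lemma is_label_lt x : is_label t L x -> x < 2 * size_at t L 0.
Proof.
case/andP=> _ lt; apply: leq_trans lt _; rewrite leq_mul2l /=.
have [->//|j0] := eqVneq (level t L x) 0.
apply: (@leq_trans (2 * size_at t L (level t L x))); first exact: leq_pmull.
by apply: size_at_lt; rewrite ?lt0n ?level_le.
Qed.

Lemma nearC lx bx ly by_ : near t lx bx ly by_ = near t ly by_ lx bx.
Proof.
rewrite /near (eq_sym lx ly) (eq_sym bx by_); congr orb.
by rewrite orbC.
Qed.

(** ** Counting near labels *)

Definition near_blocks i c j : seq nat :=
  if j == i then [:: c] else
  if j == i.+1 then [:: c %/ t ^ 3] else [seq c * t ^ 3 + d | d <- iota 0 (t ^ 3)].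

Definition near_levels i : seq nat := [:: i.-1; i; i.+1].

Lemma near_levelsP i c j d : near t i c j d ->
  (j \in near_levels i) && (d \in near_blocks i c j).
Proof.
rewrite /near /near_levels /near_blocks !inE => /or3P[] /andP[/eqP Ei /eqP Ec].
- by rewrite Ei Ec eqxx orbT inE eqxx.
- by rewrite Ei Ec eqxx !orbT eqn_leq ltnn /= inE eqxx.
- rewrite Ei Ec /= eqxx (ltn_eqF (ltnSn j)) (ltn_eqF (leqnSn j.+1)) /=.
  apply/mapP; exists (d %% t ^ 3); last exact: divn_eq.
  by rewrite mem_iota add0n ltn_mod texp_gt0.
Qed.

Lemma size_near_blocks i c j : size (near_blocks i c j) <= t ^ 3.
Proof.
rewrite /near_blocks; case: ifP => _; last case: ifP => _; rewrite ?texp_gt0 //.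
by rewrite size_map size_iota.
Qed.

Lemma capS i j : j <= i -> cap t j <= cap t i.
Proof. by move=> ji; rewrite leq_mul2l /= leq_pexp2l ?(ltnW t_ge2) //; lia. Qed.

Lemma width_near i j : i <= j.+1 -> width t L j <= t ^ 3 * width t L i.
Proof.
by move=> ij; rewrite -expnD leq_pexp2l ?(ltnW t_ge2) //; lia.
Qed.

Lemma near_levels_bound i j : j \in near_levels i -> i.-1 <= j <= i.+1.
Proof. by rewrite !inE => /or3P[] /eqP ->; lia. Qed.

(** Three levels are possible, and the number of places grows with the level; so
    three times the count for the highest one is enough. *)
Lemma count_labels (P : pred nat) (s : seq nat) i (g1 g2 : nat -> seq nat) B :
  uniq s ->
  (forall y, P y -> [&& is_label t L y, level t L y \in near_levels i,
     block1 t L y \in g1 (level t L y) & block2 t L y \in g2 (level t L y)]) ->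
  (forall j, j \in near_levels i -> size (g1 j) * size (g2 j) <= B) ->
  count P s <= 3 * (B * cap t i.+1).
Proof.
move=> s_uniq P_coord gB.
pose cands j := [seq label t L j u.1 u.2 k |
   u <- [seq (a, b) | a <- g1 j, b <- g2 j], k <- iota 0 (cap t j)].
have cand_size j : j \in near_levels i -> size (cands j) <= B * cap t i.+1.
  move=> ji; rewrite !size_allpairs size_iota leq_mul ?gB ?capS //.
  by case/andP: (near_levels_bound ji).
apply: (@leq_trans (size (flatten [seq cands j | j <- near_levels i]))); last first.
  have c1 : i.-1 \in near_levels i by rewrite !inE eqxx.
  have c2 : i \in near_levels i by rewrite !inE eqxx orbT.
  have c3 : i.+1 \in near_levels i by rewrite !inE eqxx !orbT.
  rewrite /= !size_cat /= addn0.
  have := cand_size _ c1; have := cand_size _ c2; have := cand_size _ c3.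
  by move: (B * _) => m; lia.
rewrite -size_filter; apply: uniq_leq_size; first exact: filter_uniq.
move=> y; rewrite mem_filter => /andP[/P_coord /and4P[yl ylev y1 y2] _].
have [_ _ kc ->] := label_coord yl.
apply/flattenP; exists (cands (level t L y)); first exact: map_f.
apply/allpairsP; exists ((block1 t L y, block2 t L y),
   (y - size_at t L (level t L y)) %% cap t (level t L y)); split=> //=.
  by apply/allpairsP; exists (block1 t L y, block2 t L y).
by rewrite mem_iota.
Qed.

Definition tied2 x y :=
  [&& is_label t L x, is_label t L y, near1 t L x y & near2 t L x y].

(** A vertex tied to a pair in one kind of blocks only has about [t ^ (3 * L)]
    choices, the square root of the number of vertices. *)
Definition tied3 x y z :=
  [&& tied2 x y, is_label t L z &
      [|| near1 t L x z, near1 t L y z, near2 t L x z | near2 t L y z]].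

Lemma count_tied2 x s : uniq s ->
  count (tied2 x) s <= 3 * (t ^ 3 * t ^ 3 * cap t (level t L x).+1).
Proof.
move=> s_uniq; apply: (@count_labels _ _ _
  (near_blocks (level t L x) (block1 t L x)) (near_blocks (level t L x) (block2 t L x))) => //.
  move=> y /and4P[_ -> /near_levelsP/andP[-> ->] /near_levelsP/andP[_ ->]].
  by [].
by move=> j _; apply: leq_mul; exact: size_near_blocks.
Qed.

Lemma count_near (side : bool) x s : uniq s ->
  count (fun z => is_label t L z && (if side then near1 t L x z else near2 t L x z)) s
    <= 3 * (t ^ 3 * (t ^ 3 * width t L (level t L x)) * cap t (level t L x).+1).
Proof.
move=> s_uniq; set i := level t L x.
pose all_blocks j := iota 0 (width t L j).
have all_le j : j \in near_levels i -> size (all_blocks j) <= t ^ 3 * width t L i.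
  move=> ji; rewrite size_iota width_near //.
  by case/andP: (near_levels_bound ji); lia.
apply: (@count_labels _ _ _
  (if side then near_blocks i (block1 t L x) else all_blocks)
  (if side then all_blocks else near_blocks i (block2 t L x))) => //.
  move=> z /andP[zl]; have [w1 w2 _ _] := label_coord zl; rewrite zl.
  by case: side => /near_levelsP/andP[-> ->]; rewrite mem_iota ?w1 ?w2.
move=> j ji; case: side => /=; last rewrite mulnC.
  by rewrite leq_mul ?size_near_blocks ?all_le.
by rewrite leq_mul ?size_near_blocks ?all_le.
Qed.

Lemma near_level i c j d : near t i c j d -> j <= i.+1 /\ i <= j.+1.
Proof. by case/or3P => /andP[/eqP -> _]; split; lia. Qed.

Lemma count_tied3 x y s : uniq s ->
  count (tied3 x y) s <=
    12 * (t ^ 9 * width t L (level t L x) * cap t (level t L x).+2).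
Proof.
move=> s_uniq; set i := level t L x.
have [xy|nxy] := boolP (tied2 x y); last first.
  by rewrite (@eq_count _ _ pred0) ?count_pred0 // => z; rewrite /tied3 (negPf nxy).
have [yi iy] : level t L y <= i.+1 /\ i <= (level t L y).+1.
  by case/and4P: xy => _ _ /near_level.
pose P (side : bool) v z :=
  is_label t L z && (if side then near1 t L v z else near2 t L v z).
pose m := t ^ 9 * width t L i * cap t i.+2.
have E9 : t ^ 9 = t ^ 3 * (t ^ 3 * t ^ 3) by rewrite -!expnD.
have le_cube q u v : v <= q * u -> q * (q * v) <= q * (q * q) * u.
  by move=> le; rewrite -!mulnA !leq_mul2l le !orbT.
have bx side : count (P side x) s <= 3 * m.
  apply: leq_trans (count_near side x s_uniq) _; rewrite leq_mul2l /= /m E9 -/i.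
  apply: leq_mul; last exact: capS.
  by apply: le_cube; rewrite leq_pmull ?texp_gt0.
have by_ side : count (P side y) s <= 3 * m.
  apply: leq_trans (count_near side y s_uniq) _; rewrite leq_mul2l /= /m E9.
  apply: leq_mul; last exact: capS.
  by apply: le_cube; exact: width_near.
apply: (@leq_trans (count (predU (predU (P true x) (P true y)) (predU (P false x) (P false y))) s)).
  apply: sub_count => z /and3P[_ zl]; rewrite /= /P zl /=.
  by case/or4P=> ->; rewrite ?orbT.
have U (a b : pred nat) : count (predU a b) s <= count a s + count b s.
  by rewrite -count_predUI leq_addr.
apply: leq_trans (U _ _) _.
apply: leq_trans (leq_add (U _ _) (U _ _)) _.
have := bx true; have := bx false; have := by_ true; have := by_ false.
by rewrite -/m; clearbody m; lia.
Qed.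

(** ** Counting tied pairs and triples *)

Definition numbers := iota 0 (2 * size_at t L 0).
Definition pairs := [seq (x, y) | x <- numbers, y <- [seq y <- numbers | tied2 x y]].
Definition triples :=
  [seq (u, z) | u <- pairs, z <- [seq z <- numbers | tied3 u.1 u.2 z]].

Lemma sum_by_level (F : nat -> nat) :
  \sum_(x <- numbers | is_label t L x) F (level t L x)
    <= \sum_(i < L.+1) size_at t L i * F i.
Proof.
pose lvl x := Ordinal (leq_ltn_trans (level_le x) (ltnSn L)).
rewrite (partition_big lvl xpredT) //=; apply: leq_sum => i _.
rewrite (eq_bigr (fun=> F i)) => [|x /andP[_ /eqP <-]] //.
rewrite big_const_seq iter_addn_0 mulnC leq_mul2r; apply/orP; right.
rewrite -[leqRHS](size_iota (size_at t L i)) -size_filter.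
apply: uniq_leq_size => [|x]; first exact: filter_uniq (iota_uniq _ _).
rewrite mem_filter mem_iota addnn -mul2n => /andP[/andP[xl /eqP Ei] _].
by move: xl; rewrite /is_label -Ei.
Qed.

Lemma geometric_tail M : L <= M -> \sum_(i < L.+1) t ^ (M - i) <= 2 * t ^ M.
Proof.
move=> LM.
suff part n : n <= L.+1 ->
    \sum_(i < n) t ^ (M - i) + 2 * t ^ (M - n) <= 2 * t ^ M + (n == M.+1).
  have := part _ (leqnn L.+1); rewrite eqSS; have [->|_] /= := eqVneq L M; last first.
    by rewrite addn0; apply: leq_trans; exact: leq_addr.
  have -> : M - M.+1 = 0 by lia.
  by rewrite expn0; lia.
elim: n => [|n IH nL]; first by rewrite big_ord0 subn0 add0n leq_addr.
have nM : n <= M by lia.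
have neq : (n == M.+1) = false by lia.
rewrite big_ord_recr /=; have := IH (ltnW nL); rewrite neq addn0 eqSS.
have [EnM|nM'] /= := eqVneq n M.
  have -> : M - n = 0 by lia.
  have -> : M - n.+1 = 0 by lia.
  by rewrite expn0; lia.
have -> : M - n = (M - n.+1).+1 by lia.
have : 2 * t ^ (M - n.+1) <= t * t ^ (M - n.+1) by rewrite leq_mul2r t_ge2 orbT.
by rewrite expnS; lia.
Qed.

(** The numbers of pairs and of triples of each level form geometric series. *)
Lemma size_pairs : size pairs <= 600 * t ^ (6 * L + 18).
Proof.
rewrite size_allpairs_dep sumnE big_map.
under eq_bigr do rewrite size_filter.
apply: (@leq_trans (\sum_(x <- numbers | is_label t L x)
                       3 * (t ^ 3 * t ^ 3 * cap t (level t L x).+1))).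
  rewrite [leqRHS]big_mkcond /=; apply: leq_sum => x _; case: ifP => xl.
    exact: count_tied2 (iota_uniq _ _).
  by rewrite (@eq_count _ _ pred0) ?count_pred0 // => y; rewrite /tied2 xl.
apply: leq_trans (sum_by_level (fun i => 3 * (t ^ 3 * t ^ 3 * cap t i.+1))) _.
apply: (@leq_trans (\sum_(i < L.+1) 300 * t ^ (6 * L + 18 - i))).
  apply: leq_sum => i _; rewrite size_atE /cap.
  apply: (@leq_trans (300 * (t ^ (6 * (L - i) + (2 * i + 5)) * t ^ 3 * t ^ 3 * t ^ (2 * i.+1 + 5)))).
    by apply: eq_leq; move: (t ^ _) (t ^ 3) (t ^ _) => a b c; ring.
  by rewrite -!expnD leq_mul2l /= leq_pexp2l ?(ltnW t_ge2) //; have := ltn_ord i; lia.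
rewrite -big_distrr /= -[600]/(300 * 2) -mulnA leq_mul2l /=.
by apply: geometric_tail; lia.
Qed.

Lemma size_triples : size triples <= 72 * 10 ^ 3 * t ^ (9 * L + 36).
Proof.
rewrite size_allpairs_dep sumnE big_map.
under eq_bigr do rewrite size_filter.
pose G i := 12 * (t ^ 9 * width t L i * cap t i.+2).
apply: (@leq_trans (\sum_(u <- pairs) G (level t L u.1))).
  by apply: leq_sum => u _; exact: count_tied3 (iota_uniq _ _).
rewrite big_allpairs_dep /=.
apply: (@leq_trans (\sum_(x <- numbers | is_label t L x)
          3 * (t ^ 3 * t ^ 3 * cap t (level t L x).+1) * G (level t L x))).
  rewrite [leqRHS]big_mkcond /=; apply: leq_sum => x _.
  rewrite big_const_seq count_predT size_filter iter_addn_0 mulnC; case: ifP => xl.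
    by rewrite leq_mul2r (count_tied2 _ (iota_uniq _ _)) orbT.
  by rewrite (@eq_count _ _ pred0) ?count_pred0 // => y; rewrite /tied2 xl.
apply: leq_trans (sum_by_level (fun i => 3 * (t ^ 3 * t ^ 3 * cap t i.+1) * G i)) _.
apply: (@leq_trans (\sum_(i < L.+1) 36 * 10 ^ 3 * t ^ (9 * L + 36 - i))).
  apply: leq_sum => i _; rewrite size_atE /G /cap /width.
  apply: (@leq_trans (36 * 10 ^ 3 * (t ^ (6 * (L - i) + (2 * i + 5)) * t ^ 3 * t ^ 3 *
      t ^ (2 * i.+1 + 5) * t ^ 9 * t ^ (3 * (L - i)) * t ^ (2 * i.+2 + 5)))).
    by apply: eq_leq; move: (t ^ _) (t ^ 3) (t ^ _) (t ^ _) (t ^ _) (t ^ _) => a b c d e f; ring.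
  by rewrite -!expnD leq_mul2l /= leq_pexp2l ?(ltnW t_ge2) //; have := ltn_ord i; lia.
rewrite -big_distrr /= -[72 * 10 ^ 3]/(36 * 2 * 10 ^ 3) [36 * 2 * _]mulnAC -[leqRHS]mulnA leq_mul2l.
by rewrite geometric_tail ?orbT //; lia.
Qed.

End Labels.

(** * Labelling two functional graphs *)

(** Places are given out by rank among the vertices of the same level in the
    same two blocks: by the bound on the loads of blocks, there are fewer than
    [cap t j] of them. *)
Lemma near_labelling (V : finType) (p : bool -> V -> V) (t L : nat) :
  (forall c v, #|[set u | p c u == v & u != v]| <= 2) ->
  t = 2 ^ 8 -> #|V| <= t ^ (6 * L) ->
  exists f : V -> nat,
    [/\ injective f, forall v, is_label t L (f v),
        forall v, near1 t L (f v) (f (p true v)) &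
        forall v, near2 t L (f v) (f (p false v))].
Proof.
move=> fibre tE V_le.
have t_big : 256 <= t by rewrite tE.
have t_4 : 4 %| t by rewrite tE.
have t2 : 2 <= t by rewrite tE.
have [lev [lev_L lev_lip total light]] := levels L fibre t_big t_4.
have {}total : \sum_v lweight t lev v <= 2 * t ^ (6 * L).
  by apply: leq_trans total _; rewrite leq_mul2l.
have [a [b ab]] := nested_blocks tE total light lev_L.
pose A v := a v %/ (t ^ 3) ^ lev v; pose B v := b v %/ (t ^ 3) ^ lev v.
have AB_lt v : A v < width t L (lev v) /\ B v < width t L (lev v).
  by have [range _ _ _] := ab _ (lev_L v); rewrite /width expnM; exact: range.
pose same u v := [&& lev u == lev v, A u == A v & B u == B v].
pose place v := #|[set u | same u v & enum_rank u < enum_rank v]|.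
have few v : #|[set u | same u v]| <= cap t (lev v).
  have [_ _ _ load] := ab _ (lev_L v); have {load} := load (A v) (B v).
  set j := lev v; move=> load.
  have tj0 : 0 < (t ^ 4) ^ j by rewrite -expnM texp_gt0.
  rewrite -(leq_pmul2r tj0); apply: (@leq_trans (load_bound t j)).
    apply: leq_trans load; rewrite -sum_nat_const big_mkcond [leqRHS]big_mkcond /=.
    apply: leq_sum => u _; rewrite inE /same; case: andP => // -[/eqP Eu].
    by rewrite /A /B Eu => /andP[-> ->]; rewrite leqnn /lweight Eu /=.
  have -> : cap t j * (t ^ 4) ^ j = 10 * t ^ (6 * j + 5).
    by rewrite /cap -mulnA -expnM -expnD; congr (10 * t ^ _); lia.
  rewrite /load_bound -[10]/(2 + 8) mulnDl leq_add // leq_mul2l /= leq_pexp2l //; lia.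
have place_lt v : place v < cap t (lev v).
  apply: leq_trans (few v); apply: proper_card; apply/properP; split.
    by apply/subsetP => u; rewrite !inE => /andP[].
  by exists v; rewrite !inE ?ltnn ?andbF // /same !eqxx.
pose f v := label t L (lev v) (A v) (B v) (place v).
have lev_f v : level t L (f v) = lev v.
  by have [Aw Bw] := AB_lt v; apply: level_label.
have b1_f v : block1 t L (f v) = A v.
  by have [Aw Bw] := AB_lt v; apply: block1_label.
have b2_f v : block2 t L (f v) = B v.
  by have [Aw Bw] := AB_lt v; apply: block2_label.
have near_f (g : V -> nat) u v :
    lev u <= (lev v).+1 -> lev v <= (lev u).+1 ->
    (forall i, i <= L -> lev v <= i -> lev u <= i -> g u %/ (t ^ 3) ^ i = g v %/ (t ^ 3) ^ i) ->
    near t (lev v) (g v %/ (t ^ 3) ^ lev v) (lev u) (g u %/ (t ^ 3) ^ lev u).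
  move=> uv vu g_eq; rewrite /near.
  case: (ltngtP (lev u) (lev v)) => [lt|lt|E].
  - have Ev : lev v = (lev u).+1 by apply/eqP; rewrite eqn_leq vu.
    apply/or3P/Or33; rewrite [X in X == _]Ev eqxx -divnMA -expnSr -Ev.
    by rewrite g_eq ?lev_L ?(ltnW lt) // eqxx.
  - have Eu : lev u = (lev v).+1 by apply/eqP; rewrite eqn_leq uv.
    apply/or3P/Or32; rewrite [X in X == _]Eu eqxx -divnMA -expnSr -Eu.
    by rewrite g_eq ?lev_L ?(ltnW lt) // eqxx.
  - by rewrite -E g_eq ?lev_L ?E ?eqxx.
exists f; split.
- move=> u v Efuv.
  have Elev : lev u = lev v by rewrite -!lev_f Efuv.
  have EA : A u = A v by rewrite -!b1_f Efuv.
  have EB : B u = B v by rewrite -!b2_f Efuv.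
  have Epl : place u = place v.
    have place_f x : (f x - size_at t L (lev x)) %% cap t (lev x) = place x.
      exact: place_label.
    by rewrite -!place_f Efuv Elev.
  have mono x y : same x y -> enum_rank x < enum_rank y -> place x < place y.
    move=> sxy ltxy; apply: proper_card; apply/properP; split.
      apply/subsetP => z; rewrite !inE => /andP[/and3P[/eqP Ez1 /eqP Ez2 /eqP Ez3] ltz].
      by rewrite (ltn_trans ltz ltxy) andbT /same Ez1 Ez2 Ez3.
    by exists x; rewrite !inE ?sxy ?ltxy ?ltnn ?andbF.
  apply/enum_rank_inj/val_inj/eqP; rewrite eqn_leq leqNgt [X in _ && X]leqNgt.
  apply/andP; split; apply/negP => lt.
    have := mono v u; rewrite /same Elev EA EB !eqxx => /(_ isT lt).
    by rewrite Epl ltnn.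
  have := mono u v; rewrite /same Elev EA EB !eqxx => /(_ isT lt).
  by rewrite Epl ltnn.
- by move=> v; have [Aw Bw] := AB_lt v; apply: is_label_label.
- move=> v; rewrite /near1 !lev_f !b1_f.
  have /andP[le1 le2] := forallP (forallP lev_lip v) true.
  by apply: near_f => // i iL vi ui; have [_ eq1 _ _] := ab i iL; exact: eq1.
- move=> v; rewrite /near2 !lev_f !b2_f.
  have /andP[le1 le2] := forallP (forallP lev_lip v) false.
  by apply: near_f => // i iL vi ui; have [_ _ eq2 _] := ab i iL; exact: eq2.
Qed.

(** * Pairing the vertices of each edge *)

(** An edge is listed in pairs of vertices that determine each other up to
    boundedly many choices, on average; so each pair contributes only a factor
    of [n] to the number of edges.  A vertex left over joins the last pair. *)
Fixpoint pattern (T : Type) (P2 : T -> T -> bool) (P3 : T -> T -> T -> bool) (s : seq T) :=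
  if s is x :: y :: s' then
    if s' is [:: z] then P3 x y z else P2 x y && pattern P2 P3 s'
  else nilp s.

Lemma pattern_nth (T : Type) (P2 : T -> T -> bool) (P3 : T -> T -> T -> bool) x0 s : size s != 1 ->
  (forall k, k.*2.+1 < size s -> P2 (nth x0 s k.*2) (nth x0 s k.*2.+1)) ->
  (forall k, k.*2.+3 = size s ->
     P3 (nth x0 s k.*2) (nth x0 s k.*2.+1) (nth x0 s k.*2.+2)) ->
  pattern P2 P3 s.
Proof.
have [n] := ubnP (size s); elim: n s => // n IH [|x [|y s]] // lt_n s1 h2 h3.
rewrite /=; have xy : P2 x y by have := h2 0; apply.
have rest : size s != 1 -> pattern P2 P3 s.
  move=> s1'; apply: IH => // [|k lt|k Ek]; first by move: lt_n => /=; lia.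
    by have := h2 k.+1; rewrite doubleS /=; apply.
  by have := h3 k.+1; rewrite doubleS /= -Ek; apply.
case: s h2 h3 rest {IH lt_n s1} => [|z [|z' s]] h2 h3 rest; rewrite ?xy ?rest //.
by have := h3 0; apply.
Qed.

Section Pairing.
Variables (F : hypergraph) (r : nat).
Hypothesis r_ge2 : 2 <= r.
Hypothesis unif : uniform r F.
Hypothesis deg2 : forall v : vert F, vdegree v <= 2.
Local Notation V := (vert F).
Local Notation E := (edges F).
Implicit Types (e : {set V}) (u v : V) (x : {set V} * V).

Definition incident x := (x.1 \in E) && (x.2 \in x.1).

(** The index of the other element of the pair; a leftover index is its own mate,
    so that this is an involution. *)
Definition mate i := if i < r./2.*2 then (if odd i then i.-1 else i.+1) else i.

Lemma mateK : involutive mate.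
Proof.
move=> i; rewrite /mate; case: (ltnP i r./2.*2) => [lt|]; last by rewrite ltnNge => ->.
have [oi|ei] := boolP (odd i).
  by case: i oi lt => // i /= ei lt; rewrite (ltnW lt) (negPf ei).
have -> : i.+1 < r./2.*2.
  by rewrite ltn_neqAle lt andbT; apply: contraNneq ei => Ei; rewrite -[odd i]negbK -oddS Ei odd_double.
by rewrite /= ei.
Qed.

Lemma mate_lt i : i < r -> mate i < r.
Proof.
move=> lt; have rr : r./2.*2 <= r by rewrite -[leqRHS]odd_double_half leq_addl.
rewrite /mate; case: (ltnP i r./2.*2) => // lti.
have [oi|ei] := boolP (odd i); first exact: leq_ltn_trans (leq_pred _) lt.
apply: leq_trans rr; rewrite ltn_neqAle lti andbT; apply: contraNneq ei => Ei.
by rewrite -[odd i]negbK -oddS Ei odd_double.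
Qed.

Lemma mate_neq i : i < r./2.*2 -> mate i != i.
Proof. by rewrite /mate => ->; case: ifP; case: i => [|i] //= _; lia. Qed.

Lemma mate_even k : k.*2.+1 < r -> mate k.*2 = k.*2.+1.
Proof.
move=> lt; rewrite /mate odd_double ifT //.
by move: lt; rewrite -{1}[r]odd_double_half; case: (odd r); lia.
Qed.

Lemma leftover_index i : i < r -> r./2.*2 <= i -> i = r.-1 /\ odd r.
Proof.
by move=> lt le; have := odd_double_half r; case: (odd r) => /= Er; split; lia.
Qed.

Definition ith e v i := nth v (enum e) i.
Definition idx e v := index v (enum e).

Lemma idx_lt x : incident x -> idx x.1 x.2 < r.
Proof.
by case/andP=> eE ve; rewrite -(unif eE) cardE index_mem mem_enum.
Qed.

Lemma ith_incident e v' i : e \in E -> i < r -> incident (e, ith e v' i).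
Proof.
move=> eE lt; rewrite /incident eE /= -mem_enum mem_nth //.
by rewrite -cardE (unif eE).
Qed.

Lemma idxK e v i : e \in E -> i < r -> idx e (ith e v i) = i.
Proof. by move=> eE lt; rewrite /idx index_uniq ?enum_uniq // -cardE (unif eE). Qed.

Lemma ithK e v v' : incident (e, v) -> ith e v' (idx e v) = v.
Proof. by case/andP=> _ ve; rewrite /ith nth_index // mem_enum. Qed.

(** A dart is an edge together with one of its vertices.  One involution exchanges
    the darts of a pair, the other one the two darts at a vertex of degree 2. *)
Definition pair_dart x :=
  if incident x then (x.1, ith x.1 x.2 (mate (idx x.1 x.2))) else x.

Definition turn_dart x :=
  if incident x then
    if [pick e in E | (x.2 \in e) && (e != x.1)] is Some e then (e, x.2) else x
  else x.

Lemma pair_dartK : involutive pair_dart.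
Proof.
move=> [e v]; rewrite {2}/pair_dart; case: ifP => ev /=; last by rewrite /pair_dart ev.
have eE : e \in E by case/andP: ev.
have lt := mate_lt (idx_lt ev); rewrite /pair_dart ith_incident //=.
by rewrite idxK // mateK ithK.
Qed.

(** Since the degrees are at most 2, an edge at [v] has at most one rival. *)
Lemma other_edge v e e' e'' :
  incident (e, v) -> incident (e', v) -> incident (e'', v) ->
  e != e' -> e' != e'' -> e'' = e.
Proof.
case/andP=> eE ve /andP[e'E ve'] /andP[e''E ve''] n1 n2; apply/eqP.
apply: contraTT (deg2 v) => n3; rewrite -ltnNge /vdegree.
have : #|[set e; e'; e'']| = 3.
  by rewrite -setUA cardsU1 cards2 !inE negb_or n1 (eq_sym e) n3 n2.
move=> <-; apply: subset_leq_card; apply/subsetP => a.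
by rewrite !inE => /orP[/orP[]|] /eqP ->; apply/andP.
Qed.

Lemma turn_dart_other v e e' :
  incident (e, v) -> incident (e', v) -> e != e' -> turn_dart (e, v) = (e', v).
Proof.
move=> ev e'v n; rewrite /turn_dart ev /=; case: pickP => [a /andP[aE /andP[va na]]|none].
  by congr (_, _); apply: (@other_edge v e' e a); rewrite // /incident ?aE // eq_sym.
by case/andP: e'v => e'E ve'; have := none e'; rewrite /= e'E ve' eq_sym n.
Qed.

Lemma turn_dartK : involutive turn_dart.
Proof.
move=> [e v]; have [ev|nev] := boolP (incident (e, v)); last first.
  by rewrite /turn_dart (negPf nev) (negPf nev).
rewrite {2}/turn_dart ev /=; case: pickP => [a /andP[aE /andP[va na]]|none] /=.
  by apply: turn_dart_other; rewrite /incident ?aE.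
by rewrite /turn_dart ev /=; case: pickP => // a; rewrite none.
Qed.

(** The darts at an edge that form a pair, and the two darts at a vertex, get
    different colours.  A vertex [v] then points in graph [c] to a vertex of
    colour [c], in the edge where [v] has the other colour: to its mate, or, if
    [v] is leftover, to a vertex of the last pair.  So [v] has one pointer in
    each graph at most, and in each graph it is pointed to from one edge only. *)
Lemma pointers : exists p : bool -> V -> V,
  (forall c v, #|[set u | p c u == v & u != v]| <= 2) /\
  forall e, e \in E -> forall v0 k,
    (k.*2.+1 < r -> exists c,
       p c (ith e v0 k.*2) = ith e v0 k.*2.+1 /\ p (~~ c) (ith e v0 k.*2.+1) = ith e v0 k.*2) /\
    (k.*2.+3 = r -> exists c,
       p c (ith e v0 k.*2.+2) \in [:: ith e v0 k.*2; ith e v0 k.*2.+1]).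
Proof.
have [col colP] := two_colouring pair_dartK turn_dartK.
have col_turn v e e' : incident (e, v) -> incident (e', v) -> e != e' ->
    col (e', v) = ~~ col (e, v).
  move=> ev e'v n; have [_] := colP (e, v); rewrite (turn_dart_other ev e'v n); apply.
  by rewrite xpair_eqE eqxx andbT eq_sym.
have col_mate e v i : e \in E -> i < r./2.*2 -> i < r ->
    col (e, ith e v (mate i)) = ~~ col (e, ith e v i).
  move=> eE lti ltr; have ev := ith_incident v eE ltr.
  have [] := colP (e, ith e v i); rewrite /pair_dart ev /= idxK // => + _.
  have -> : ith e (ith e v i) (mate i) = ith e v (mate i).
    by apply: set_nth_default; rewrite -cardE (unif eE) mate_lt.
  apply; rewrite xpair_eqE eqxx /=; apply/eqP => Ei.
  have := mate_neq lti; rewrite -(idxK v eE (mate_lt ltr)) Ei idxK // eqxx.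
  by [].
pose target c e v := let i := idx e v in
  if i < r./2.*2 then ith e v (mate i) else
  let u := ith e v (r - 3) in if col (e, u) == c then u else ith e v (r - 2).
pose p c v := if [pick e in E | (v \in e) && (col (e, v) != c)] is Some e
              then target c e v else v.
have p_target c e v : incident (e, v) -> col (e, v) = ~~ c -> p c v = target c e v.
  move=> ev Ec; rewrite /p; case: pickP => [a /andP[aE /andP[va Ca]]|none]; last first.
    by case/andP: ev => eE ve; have := none e; rewrite /= eE ve Ec; case: (c).
  have [->//|n] := eqVneq a e; have av : incident (a, v) by rewrite /incident aE.
  by move: Ca; rewrite (col_turn _ _ _ ev av) ?Ec 1?eq_sym // negbK eqxx.
have p_move c v : p c v != v -> exists2 e, incident (e, v) & col (e, v) = ~~ c.
  rewrite /p; case: pickP => [a /andP[aE /andP[va Ca]] _|]; last by rewrite eqxx.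
  by exists a; rewrite /incident ?aE //; move: Ca; case: (col _); case: c.
have r_odd3 : odd r -> 3 <= r by case: r r_ge2 => [|[|[]]].
have ith_dflt e v v' i : e \in E -> i < r -> ith e v i = ith e v' i.
  by move=> eE lt; apply: set_nth_default; rewrite -cardE (unif eE).
have last_pair e v c : e \in E -> odd r -> col (e, ith e v (r - 3)) != c ->
    col (e, ith e v (r - 2)) = c.
  move=> eE ro nc; have r3 := r_odd3 ro; have Er := odd_double_half r.
  have Em : mate (r - 3) = r - 2.
    have Ek : (r./2.-1).*2 = r - 3 by rewrite ro in Er; lia.
    by rewrite -Ek mate_even Ek; lia.
  rewrite ro in Er; rewrite -Em col_mate //; [|lia|lia].
  by move: nc; case: (col _); case: (c).
have target_col c e v : incident (e, v) -> col (e, v) = ~~ c ->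
    incident (e, target c e v) /\ col (e, target c e v) = c.
  move=> ev Ec; have eE : e \in E by case/andP: ev.
  have lt := idx_lt ev; rewrite /target; case: ifP => lti.
    by rewrite ith_incident ?mate_lt // col_mate // ithK // Ec negbK.
  have le : r./2.*2 <= idx e v by rewrite leqNgt lti.
  have [_ ro] := leftover_index lt le.
  have r3 := r_odd3 ro.
  have [lt3 lt2] : r - 3 < r /\ r - 2 < r by lia.
  case: ifP => [/eqP Cu|/negbT nc]; first by rewrite ith_incident.
  by rewrite (last_pair _ _ _ eE ro nc) ith_incident.
exists p; split.
- move=> c v; have [->|/set0Pn[u0]] := eqVneq [set u | p c u == v & u != v] set0.
    by rewrite cards0.
  rewrite inE => /andP[/eqP pu0 nu0].
  have [e eu0 Ce] : exists2 e, incident (e, u0) & col (e, u0) = ~~ c.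
    by apply: p_move; rewrite pu0 eq_sym.
  have eE : e \in E by case/andP: eu0.
  have [ev Cv] := target_col _ _ _ eu0 Ce; rewrite -(p_target _ _ _ eu0 Ce) pu0 in ev Cv.
  apply: (@leq_trans #|[set ith e v (mate (idx e v)); ith e v r.-1]|); last first.
    by rewrite cards2; case: (_ != _).
  apply/subset_leq_card/subsetP => u; rewrite inE => /andP[/eqP pu nu].
  have [a au Ca] : exists2 a, incident (a, u) & col (a, u) = ~~ c.
    by apply: p_move; rewrite pu eq_sym.
  have [av Cav] := target_col _ _ _ au Ca; rewrite -(p_target _ _ _ au Ca) pu in av Cav.
  have Eae : a = e.
    apply/eqP; apply/negPn/negP => n; move: Cav; rewrite (col_turn _ _ _ ev av) ?Cv 1?eq_sym //.
    by case: (c).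
  rewrite {a}Eae in au Ca av Cav *; have lt := idx_lt au.
  rewrite !inE; have := p_target _ _ _ au Ca; rewrite pu /target; case: ifP => lti Ev.
    by rewrite [in idx e v]Ev idxK ?mate_lt // mateK (ithK v au) eqxx.
  have le : r./2.*2 <= idx e u by rewrite leqNgt lti.
  have [Ei _] := leftover_index lt le.
  by rewrite -Ei (ithK v au) eqxx orbT.
- move=> e eE v0 k; split=> [lt|Er].
    have lt' := ltnW lt; have i1 := ith_incident v0 eE lt'; have i2 := ith_incident v0 eE lt.
    have lti : k.*2 < r./2.*2 by move: lt; rewrite -{1}[r]odd_double_half; case: (odd r); lia.
    have lti' : k.*2.+1 < r./2.*2 by move: lt; rewrite -{1}[r]odd_double_half; case: (odd r); lia.
    have mk := mate_even lt; have mk' : mate k.*2.+1 = k.*2 by rewrite -mk mateK.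
    have Ck := col_mate e v0 _ eE lti lt'; rewrite mk in Ck.
    exists (~~ col (e, ith e v0 k.*2)); split.
      rewrite (p_target _ e) ?negbK // /target idxK // lti mk; exact: ith_dflt.
    rewrite (p_target _ e) ?negbK // /target idxK // lti' mk'; exact: ith_dflt.
  have ltr : k.*2.+2 < r by rewrite -Er.
  have iz := ith_incident v0 eE ltr; exists (~~ col (e, ith e v0 k.*2.+2)).
  rewrite (p_target _ e) ?negbK // /target idxK //.
  have -> : (k.*2.+2 < r./2.*2) = false.
    by apply/negbTE; rewrite -leqNgt -Er /= uphalf_double; lia.
  have -> : r - 3 = k.*2 by lia.
  have -> : r - 2 = k.*2.+1 by lia.
  rewrite !(ith_dflt e _ v0) //; try lia.
  by case: ifP => _; rewrite !inE eqxx ?orbT.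
Qed.

End Pairing.

(** * The universal hypergraph *)

Section Universal.
Variable t : nat.
Hypothesis t_ge2 : 2 <= t.

(** The least [L] with [n <= t ^ (6 * L)], found by counting upwards. *)
Definition height n := iter n (fun L => L + (t ^ (6 * L) < n)) 0.

Lemma height_ge n : n <= t ^ (6 * height n).
Proof.
suff part i : i <= n ->
    let L := iter i (fun L => L + (t ^ (6 * L) < n)) 0 in (n <= t ^ (6 * L)) || (L == i).
  have /orP[//|/eqP En] := part n (leqnn n); rewrite /height En.
  apply: leq_trans (ltnW (ltn_expl n t_ge2)) _; rewrite leq_pexp2l ?(ltnW t_ge2) //.
  exact: leq_pmull.
elim: i => [|i IH] lt /=; first by rewrite orbT.
set L := iter _ _ _ in IH *; have /orP[ge|/eqP E] := IH (ltnW lt).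
  by rewrite [_ < n]ltnNge ge addn0 ge.
by have [le|gt] := leqP n (t ^ (6 * L)); rewrite ?addn0 ?le // addn1 E eqxx orbT.
Qed.

Lemma height_le n : 0 < n -> t ^ (6 * height n) <= t ^ 6 * n.
Proof.
move=> n0; rewrite /height; move: {1}n => i; elim: i => [|i IH] /=.
  by rewrite muln0 expn0 muln_gt0 texp_gt0.
set L := iter _ _ _ in IH *; case: ltnP => [lt|_]; last by rewrite addn0.
by rewrite addn1 mulnS expnD leq_mul2l (ltnW lt) orbT.
Qed.

Definition num_vertices n := 2 * size_at t (height n) 0.

Lemma num_verticesE n : num_vertices n = 20 * t ^ 5 * t ^ (6 * height n).
Proof.
have -> : 20 * t ^ 5 * t ^ (6 * height n) = 2 * (10 * t ^ (5 + 6 * height n)).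
  by rewrite expnD; move: (t ^ 5) (t ^ _) => a b; ring.
have -> : 5 + 6 * height n = 6 * (height n - 0) + (2 * 0 + 5) by lia.
by rewrite -size_atE.
Qed.

Variable r : nat.

Definition edge_seq n (s : seq nat) := pattern (tied2 t (height n)) (tied3 t (height n)) s.

Definition members n (s : seq nat) : {set 'I_(num_vertices n)} := [set i | val i \in s].

Definition edge_set n : {set {set 'I_(num_vertices n)}} :=
  [set e : {set 'I_(num_vertices n)} | (#|e| == r) &&
    [exists s : r.-tuple 'I_(num_vertices n),
       (e == members n (map val s)) && edge_seq n (map val s)]].

Lemma edge_seq_lt n s : edge_seq n s -> all (fun x => x < num_vertices n) s.
Proof.
rewrite /edge_seq; have [m] := ubnP (size s); elim: m s => // m IH [|x [|y s]] //= lt.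
have pair_lt : tied2 t (height n) x y -> (x < num_vertices n) && (y < num_vertices n).
  by case/and4P => xl yl _ _; rewrite /num_vertices !is_label_lt.
case: s lt => [|z [|z' s]] lt.
- by rewrite /= !andbT => /pair_lt/andP[-> ->].
- by case/and3P=> /pair_lt/andP[-> ->] zl _; rewrite /= andbT; exact: is_label_lt.
- by case/andP=> /pair_lt/andP[-> ->]; apply: IH; move: lt => /=; lia.
Qed.

Lemma card_members n s : all (fun x => x < num_vertices n) s -> uniq s -> #|members n s| = size s.
Proof.
move=> lt us; have Es : s = map val (pmap insub s : seq 'I_(num_vertices n)).
  rewrite pmap_filter; last exact: insubK.
  by apply/esym/all_filterP; apply: sub_all lt => x lt; rewrite insubT.
have uq : uniq (pmap insub s : seq 'I_(num_vertices n)) by rewrite pmap_sub_uniq.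
rewrite {2}Es size_map -(card_uniqP uq); apply: eq_card => i.
by rewrite inE {1}Es mem_map //; exact: val_inj.
Qed.

(** The cardinality alone excludes repetitions and numbers out of range. *)
Lemma members_perm n s : #|members n s| = size s ->
  perm_eq (map val (enum (members n s))) s.
Proof.
move=> card_s; have us : uniq (map val (enum (members n s))).
  by rewrite map_inj_uniq ?enum_uniq //; exact: val_inj.
have sub : {subset map val (enum (members n s)) <= s}.
  by move=> x /mapP[i]; rewrite mem_enum inE => si ->.
have le : size s <= size (map val (enum (members n s))) by rewrite size_map -cardE card_s.
apply: uniq_perm => //; first exact: leq_size_uniq sub le.
by have [] := uniq_min_size us sub le.
Qed.

(** A test on numbers: an ordering of the listed vertices that follows the pattern
    is found among their permutations, and it consists of vertices anyway. *)
Lemma members_edge n vs : size vs = r ->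
  (members n vs \in edge_set n) = uniq vs && has (edge_seq n) (permutations vs).
Proof.
move=> Er; rewrite inE; apply/andP/andP => [[card_r]|[us]].
  case/existsP=> s /andP[/eqP Es ps].
  have vsP : perm_eq (map val (enum (members n vs))) vs.
    by apply: members_perm; rewrite Er; apply/eqP.
  have sP : perm_eq (map val (enum (members n vs))) (map val s).
    by rewrite Es; apply: members_perm; rewrite -Es (eqP card_r) size_map size_tuple.
  split.
    by rewrite -(perm_uniq vsP) map_inj_uniq ?enum_uniq //; exact: val_inj.
  apply/hasP; exists (map val s); last exact: ps.
  by rewrite mem_permutations -(permPl sP).
case/hasP=> s; rewrite mem_permutations => pe ps; have lt := edge_seq_lt ps.
have Es : s = map val (pmap insub s : seq 'I_(num_vertices n)).
  rewrite pmap_filter; last exact: insubK.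
  by apply/esym/all_filterP; apply: sub_all lt => x lt; rewrite insubT.
have Em : members n vs = members n s.
  by apply/setP => i; rewrite !inE (perm_mem pe).
split; first by rewrite Em card_members ?(perm_uniq pe) // (perm_size pe) Er.
have sz : size (pmap insub s : seq 'I_(num_vertices n)) == r.
  by rewrite -(size_map val) -Es (perm_size pe) Er.
by apply/existsP; exists (Tuple sz); rewrite /= -Es Em eqxx.
Qed.

Lemma uniform_edges n : uniform r (Hypergraph (edge_set n)).
Proof. by move=> e; rewrite inE => /andP[/eqP]. Qed.

(** If [p c x = y] and [p (~~ c) y = x], then [x] and [y] are near in one kind of
    blocks because of the first equation, and in the other because of the
    second.  A leftover vertex has only one of the two. *)
Lemma universal_edges n : t = 2 ^ 8 -> 2 <= r ->
  universal (bounded_family r n 2) (Hypergraph (edge_set n)).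
Proof.
move=> tE r2 F [unif card_V deg2].
have [p [fibre p_edge]] := pointers r2 unif deg2.
have [f [f_inj f_lab f1 f2]] := near_labelling fibre tE (leq_trans card_V (height_ge n)).
have f_lt v : f v < num_vertices n by exact: is_label_lt.
pose g v : 'I_(num_vertices n) := Ordinal (f_lt v).
have g_inj : injective g by move=> u v /(congr1 val); exact: f_inj.
exists g; split=> // e eE.
have card_e : #|e| = r := unif e eE.
have -> : [set g x | x in e] = members n (map f (enum e)).
  apply/setP => i; rewrite inE; apply/imsetP/mapP => [[x xe ->]|[x xe Ei]].
    by exists x; rewrite ?mem_enum.
  by exists x; [move: xe; rewrite mem_enum | exact: val_inj].
have size_s : size (map f (enum e)) = r by rewrite size_map -cardE.
change (members n (map f (enum e)) \in edge_set n); rewrite members_edge //.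
rewrite map_inj_uniq // enum_uniq; apply/hasP; exists (map f (enum e)).
  by rewrite mem_permutations.
have [v0 _] : exists v, v \in e by apply/set0Pn; rewrite -card_gt0 card_e; lia.
have nth_f i : i < r -> nth (f v0) (map f (enum e)) i = f (ith e v0 i).
  by move=> lt; rewrite (nth_map v0) // -cardE card_e.
have near1C x y : near1 t (height n) x y = near1 t (height n) y x by exact: nearC.
have near2C x y : near2 t (height n) x y = near2 t (height n) y x by exact: nearC.
have tied k : k.*2.+1 < r -> tied2 t (height n) (f (ith e v0 k.*2)) (f (ith e v0 k.*2.+1)).
  move=> lt; have [/(_ lt)[c [Ec Ec']] _] := p_edge e eE v0 k.
  rewrite /tied2 !f_lab /=.
  case: c Ec Ec' => /= Ec Ec'.
    by have := f1 (ith e v0 k.*2); have := f2 (ith e v0 k.*2.+1); rewrite Ec Ec' near2C => -> ->.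
  by have := f2 (ith e v0 k.*2); have := f1 (ith e v0 k.*2.+1); rewrite Ec Ec' near1C => -> ->.
apply: (@pattern_nth _ _ _ (f v0)); rewrite size_s; first by lia.
  by move=> k lt; rewrite !nth_f ?(ltnW lt) //; exact: tied.
move=> k Ek; have lt2 : k.*2.+2 < r by rewrite -Ek.
have lt1 := ltnW lt2; rewrite !nth_f ?(ltnW lt1) // /tied3 tied // f_lab /=.
have [_ /(_ Ek)[c]] := p_edge e eE v0 k; rewrite !inE.
case: c => /orP[] /eqP Ec.
- by have := f1 (ith e v0 k.*2.+2); rewrite Ec near1C => ->.
- by have := f1 (ith e v0 k.*2.+2); rewrite Ec near1C => ->; rewrite !orbT.
- by have := f2 (ith e v0 k.*2.+2); rewrite Ec near2C => ->; rewrite !orbT.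
- by have := f2 (ith e v0 k.*2.+2); rewrite Ec near2C => ->; rewrite !orbT.
Qed.

(** ** Counting the edges *)

(** An upper bound for the lists that follow the pattern, in a form that is easy
    to count. *)
Fixpoint edge_seqs n k : seq (seq nat) :=
  match k with
  | 0 => [:: [::]]
  | 3 => [seq [:: u.1.1; u.1.2; u.2] | u <- triples t (height n)]
  | k'.+2 => [seq u.1 :: u.2 :: s | u <- pairs t (height n), s <- edge_seqs n k']
  | _ => [::]
  end.

Lemma tied2_pairs n x y : tied2 t (height n) x y -> (x, y) \in pairs t (height n).
Proof.
move=> xy; have /and4P[xl yl _ _] := xy.
apply/allpairsPdep; exists x, y; split=> //; first by rewrite mem_iota add0n is_label_lt.
by rewrite mem_filter xy mem_iota add0n is_label_lt.
Qed.

Lemma mem_edge_seqs n s : edge_seq n s -> s \in edge_seqs n (size s).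
Proof.
rewrite /edge_seq; have [m] := ubnP (size s); elim: m s => // m IH [|x [|y s]] //= lt.
case: s lt => [|z [|z' s]] lt.
- rewrite andbT => /tied2_pairs xy.
  by apply/allpairsP; exists ((x, y), [::]); split; rewrite ?inE.
- case/and3P=> xy zl zn; apply/mapP; exists ((x, y), z) => //.
  apply/allpairsPdep; exists (x, y), z; split=> //; first exact: tied2_pairs.
  by rewrite mem_filter /tied3 /= xy zl zn mem_iota add0n is_label_lt.
- case/andP=> /tied2_pairs xy ps.
  have rest : z :: z' :: s \in edge_seqs n (size (z :: z' :: s)).
    by apply: IH => //; move: lt => /=; lia.
  have : [:: x, y, z, z' & s] \in [seq u.1 :: u.2 :: s0 | u <- pairs t (height n),
      s0 <- edge_seqs n (size (z :: z' :: s))].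
    by apply/allpairsP; exists ((x, y), z :: z' :: s).
  by [].
Qed.

Definition edge_factor := 72 * 10 ^ 3 * t ^ 36.

(** With [m = t ^ (3 * height n)], about the square root of [n], there are [O(m ^ 2)]
    pairs and [O(m ^ 3)] triples. *)
Lemma size_edge_seqs n k :
  size (edge_seqs n k) <= (edge_factor * t ^ (3 * height n)) ^ k.
Proof.
set L := height n; set B := edge_factor * _.
have K0 : 0 < edge_factor 
  by rewrite /edge_factor muln_gt0; apply/andP; split; [rewrite muln_gt0 expn_gt0 | exact: texp_gt0].
have Kexp i : 0 < i -> edge_factor <= edge_factor ^ i by move=> i0; rewrite -{1}[edge_factor]expn1 leq_pexp2l.
have BE i : B ^ i = edge_factor ^ i * t ^ (3 * i * L).
  by rewrite expnMn -expnM; congr (_ * t ^ _); lia.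
have two : size (pairs t L) <= B ^ 2.
  apply: leq_trans (size_pairs L t_ge2) _; rewrite BE expnD mulnCA mulnC leq_mul //.
  apply: leq_trans (Kexp 2 isT); apply: leq_mul; last by rewrite leq_pexp2l ?(ltnW t_ge2).
  by rewrite -[600]/(6 * 10 ^ 2) leq_mul // leq_pexp2l.
have three : size (triples t L) <= B ^ 3.
  apply: leq_trans (size_triples L t_ge2) _; rewrite BE expnD mulnCA mulnC leq_mul //.
  exact: Kexp 3 isT.
have [m] := ubnP k; elim: m k => // m IH [|[|[|[|k]]]] // lt.
- by rewrite [edge_seqs n 2]/(allpairs _ _ _) size_allpairs muln1.
- by rewrite size_map.
- rewrite [edge_seqs n _]/(allpairs _ _ _) size_allpairs -[k.+4]/(2 + k.+2) expnD leq_mul //.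
  by apply: (IH k.+2); lia.
Qed.

Lemma card_edge_set n : #|edge_set n| <= (edge_factor * t ^ (3 * height n)) ^ r.
Proof.
apply: leq_trans (size_edge_seqs n r).
rewrite -(size_map (members n)); apply: leq_trans (card_size _).
apply/subset_leq_card/subsetP => e.
rewrite inE => /andP[_ /existsP[s /andP[/eqP -> ps]]].
apply: map_f; have := mem_edge_seqs ps; by rewrite size_map size_tuple.
Qed.

End Universal.

(** * Functions computed in polynomial time *)

Definition poly_bound (b : nat -> nat) := exists d, forall X, b X <= (X + 2) ^ d.

Lemma poly_const c : poly_bound (fun=> c).
Proof.
exists c => X; apply: leq_trans (ltnW (ltn_expl c (isT : 1 < 2))) _.
by case: c => [|c] //; rewrite leq_exp2r // leq_addl.
Qed.

Lemma poly_id : poly_bound id.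
Proof. by exists 1 => X; rewrite expn1 leq_addr. Qed.

Lemma base_gt0 X d : 0 < (X + 2) ^ d.
Proof. by rewrite expn_gt0 addn2. Qed.

Lemma poly_add b1 b2 : poly_bound b1 -> poly_bound b2 -> poly_bound (fun X => b1 X + b2 X).
Proof.
move=> [d1 h1] [d2 h2]; exists (maxn d1 d2).+1 => X.
apply: leq_trans (leq_add (h1 X) (h2 X)) _.
apply: (@leq_trans (2 * (X + 2) ^ maxn d1 d2)); last first.
  by rewrite expnS leq_mul2r leq_addl orbT.
by rewrite mul2n -addnn leq_add // leq_pexp2l ?addn2 // (leq_maxl, leq_maxr).
Qed.

Lemma poly_mul b1 b2 : poly_bound b1 -> poly_bound b2 -> poly_bound (fun X => b1 X * b2 X).
Proof.
move=> [d1 h1] [d2 h2]; exists (d1 + d2) => X; rewrite expnD; exact: leq_mul.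
Qed.

Lemma poly_exp d b : poly_bound b -> poly_bound (fun X => b X ^ d).
Proof.
move=> pb; elim: d => [|d IH]; first exact: poly_const.
have [e h] := poly_mul pb IH; exists e => X; rewrite expnS; exact: h.
Qed.

(** The program depends on the registers [loc] of the arguments, the bound does
    not.  It uses the registers from [s] on and leaves its result in [s], so
    that programs can be nested. *)
Definition computes_in (b : nat -> nat) (k : nat) (f : seq nat -> nat) :=
  forall (loc : seq nat) s, size loc = k -> all (fun x => x < s) loc ->
  exists c, forall m X, all (fun x => m x <= X) loc ->
    [/\ (exec c m).1 s = f (map m loc), f (map m loc) <= b X,
        forall x, x < s -> (exec c m).1 x = m x & (exec c m).2 <= b X].

Definition computes k f := exists d, computes_in (fun X => (X + 2) ^ d) k f.

Lemma computes_intro b k f : poly_bound b -> computes_in b k f -> computes k f.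
Proof.
move=> [d bd] cf; exists d => loc s Ek lt; have [c cP] := cf loc s Ek lt.
exists c => m X le; have [v1 v2 v3 v4] := cP m X le.
by split=> //; apply: leq_trans (bd X).
Qed.

Lemma computes_ext k f g : (forall v, size v = k -> f v = g v) -> computes k f -> computes k g.
Proof.
move=> fg [d cf]; exists d => loc s Ek lt; have [c cP] := cf loc s Ek lt.
by exists c => m X le; rewrite -fg ?size_map //; exact: cP.
Qed.

Lemma computes_arg k i : i < k -> computes k (fun v => nth 0 v i).
Proof.
move=> ik; apply: (@computes_intro (fun X => X + 1)); first exact: poly_add poly_id (poly_const _).
move=> loc s Ek lt; exists (Copy s (nth 0 loc i)) => m X le.
have il : nth 0 loc i \in loc by rewrite mem_nth ?Ek.
rewrite /= /upd eqxx (nth_map 0) ?Ek //; split=> //; last exact: leq_addl.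
  by apply: leq_trans (allP le _ il) (leq_addr _ _).
by move=> x xs; rewrite ltn_eqF.
Qed.

Lemma computes_const k a : computes k (fun=> a).
Proof.
apply: (@computes_intro (fun X => a + 1)); first exact: poly_const.
move=> loc s Ek lt; exists (Const s a) => m X le; rewrite /= /upd eqxx; split=> //.
- exact: leq_addr.
- by move=> x xs; rewrite ltn_eqF.
- exact: leq_addl.
Qed.

Lemma computes_succ : computes 1 (fun v => (nth 0 v 0).+1).
Proof.
apply: (@computes_intro (fun X => X + 2)); first exact: poly_add poly_id (poly_const _).
move=> [|y [|? ?]] // s _ /=; rewrite andbT => lt.
exists (Seq (Copy s y) (Succ s)) => m X; rewrite /= andbT => le.
rewrite /upd eqxx; split=> //; last exact: leq_addl.
  by rewrite addn2 ltnS ltnW.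
by move=> x xs; rewrite ltn_eqF.
Qed.

Lemma computes_pred : computes 1 (fun v => (nth 0 v 0).-1).
Proof.
apply: (@computes_intro (fun X => X + 2)); first exact: poly_add poly_id (poly_const _).
move=> [|y [|? ?]] // s _ /=; rewrite andbT => lt.
exists (Seq (Copy s y) (Pred s)) => m X; rewrite /= andbT => le.
rewrite /upd eqxx; split=> //; last exact: leq_addl.
  by apply: leq_trans (leq_pred _) (leq_trans le (leq_addr _ _)).
by move=> x xs; rewrite ltn_eqF.
Qed.

Lemma all_lt_trans s s' loc : s <= s' ->
  all (fun x => x < s) loc -> all (fun x => x < s') loc.
Proof. by move=> ss; apply: sub_all => x lt; exact: leq_trans lt ss. Qed.

Lemma map_nth_args k (v : seq nat) : size v = k -> map (nth 0 v) (iota 0 k) = v.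
Proof. by move=> <-; rewrite map_nth_iota0 ?take_size. Qed.

Lemma computes_value k f : computes k f ->
  exists d, forall v X, size v = k -> all (fun a => a <= X) v -> f v <= (X + 2) ^ d.
Proof.
move=> [d cf]; exists d => v X sv vX.
have [|c cP] := cf (iota 0 k) k (size_iota _ _).
  by apply/allP => x; rewrite mem_iota.
have Ev := map_nth_args sv.
have [|_ + _ _] := cP (nth 0 v) X; last by rewrite Ev.
by rewrite -(all_map _ (fun a => a <= X)) Ev.
Qed.

(** The arguments of a composed function are prepared in consecutive registers. *)
Lemma computes_list k hs : (forall i, i < size hs -> computes k (nth (fun=> 0) hs i)) ->
  exists b, poly_bound b /\
  forall (loc : seq nat) s, size loc = k -> all (fun x => x < s) loc ->
  exists c, forall m X, all (fun x => m x <= X) loc ->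
    [/\ map (exec c m).1 (iota s (size hs)) = [seq h (map m loc) | h <- hs],
        all (fun a => a <= b X) [seq h (map m loc) | h <- hs],
        forall x, x < s -> (exec c m).1 x = m x & (exec c m).2 <= b X].
Proof.
elim: hs => [|h hs IH] hP.
  exists (fun=> 1); split; first exact: poly_const.
  move=> loc s Ek lt; exists (Const s 0) => m X le; split=> // x xs.
  by rewrite /= /upd ltn_eqF.
have [d ch] := hP 0 isT; have [|b [pb cs]] := IH; first by move=> i; exact: hP i.+1.
exists (fun X => (X + 2) ^ d + b X); split.
  by apply: poly_add pb; exists d.
move=> loc s Ek lt; have [c1 c1P] := ch loc s Ek lt.
have [c2 c2P] := cs loc s.+1 Ek (all_lt_trans (leqnSn s) lt).
exists (Seq c1 c2) => m X le; have [v1 v2 v3 v4] := c1P m X le.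
have Em : map (exec c1 m).1 loc = map m loc.
  by apply/eq_in_map => x xl; rewrite v3 // (allP lt).
have [|w1 w2 w3 w4] := c2P (exec c1 m).1 X.
  by apply/allP => x xl; rewrite v3 ?(allP lt) // (allP le).
rewrite Em in w1 w2; split=> /=.
- by rewrite w1 w3 // v1.
- rewrite (leq_trans v2 (leq_addr _ _)) /=.
  by apply: sub_all w2 => a la; exact: leq_trans la (leq_addl _ _).
- by move=> x xs; rewrite w3 ?v3 // ltnW.
- exact: leq_add.
Qed.

Lemma computes_comp k g hs : computes (size hs) g ->
  (forall i, i < size hs -> computes k (nth (fun=> 0) hs i)) ->
  computes k (fun v => g [seq h v | h <- hs]).
Proof.
move=> [d cg] /computes_list[b [pb ch]].
apply: (@computes_intro (fun X => b X + ((b X + 2) ^ d + 1))).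
  apply: poly_add pb (poly_add (poly_exp _ (poly_add pb (poly_const _))) (poly_const _)).
move=> loc s Ek lt; have [c1 c1P] := ch loc s Ek lt.
have [|c2 c2P] := cg (iota s (size hs)) (s + size hs) (size_iota _ _).
  by apply/allP => x; rewrite mem_iota => /andP[].
exists (Seq (Seq c1 c2) (Copy s (s + size hs))) => m X le.
have [v1 v2 v3 v4] := c1P m X le.
have [|w1 w2 w3 w4] := c2P (exec c1 m).1 (b X); first by rewrite -(all_map _ (fun a => a <= b X)) v1.
rewrite v1 in w1 w2; split=> /=.
- by rewrite /upd eqxx w1.
- by apply: leq_trans w2 _; rewrite addnCA; exact: leq_addr.
- by move=> x xs; rewrite /upd ltn_eqF // w3 ?v3 // (leq_trans xs) ?leq_addr.
- by rewrite -addnA leq_add // leq_add2r.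
Qed.

(** The intermediate values have to be bounded as well: an iterated doubling runs
    for exponential time. *)
Lemma computes_iteri k g step init : computes k g -> computes k.+2 step -> computes k init ->
  (exists d, forall v X i, size v = k -> all (fun a => a <= X) v -> i <= g v ->
     iteri i (fun j x => step [:: j, x & v]) (init v) <= (X + 2) ^ d) ->
  computes k (fun v => iteri (g v) (fun j x => step [:: j, x & v]) (init v)).
Proof.
move=> [dg cg] [ds cs] [di ci] [d small].
pose Y X := (X + 2) ^ d + (X + 2) ^ dg + X.
have pY : poly_bound Y.
  by apply: poly_add poly_id; apply: poly_add; [exists d | exists dg].
pose T X := (Y X + 2) ^ ds + 3.
have pT : poly_bound T.
  exact: poly_add (poly_exp _ (poly_add pY (poly_const _))) (poly_const _).
apply: (@computes_intro (fun X => (X + 2) ^ di + (X + 2) ^ dg + (X + 2) ^ d + 2 + (X + 2) ^ dg * T X)).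
  apply: poly_add; last by apply: poly_mul pT; exists dg.
  by apply: poly_add (poly_const _); apply: poly_add; [apply: poly_add; [exists di | exists dg] | exists d].
move=> loc s Ek lt.
(* register s: the value; s + 1: the counter; s + 2: the number of rounds *)
have [c1 c1P] := ci loc s Ek lt.
have [c2 c2P] := cg loc s.+2 Ek (all_lt_trans (leq_addl 2 s) lt).
have [||c3 c3P] := cs [:: s.+1, s & loc] s.+3; first by rewrite /= Ek.
  by apply/and3P; split; [exact: leq_addl 1 _ | exact: leq_addl 2 _ | exact: all_lt_trans (leq_addl 3 s) lt].
pose body := Seq c3 (Seq (Copy s s.+3) (Succ s.+1)).
exists (Seq (Seq c1 (Const s.+1 0)) (Seq c2 (Loop s.+2 body))) => m X le.
have [v1 v2 v3 v4] := c1P m X le.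
set m1 := upd (exec c1 m).1 s.+1 0.
have m1s : m1 s = init (map m loc) by rewrite /m1 /upd ltn_eqF // v1.
have m1l x : x < s -> m1 x = m x by move=> xs; rewrite /m1 /upd ltn_eqF ?v3 // ltnW.
have E1 : map m1 loc = map m loc.
  by apply/eq_in_map => x xl; rewrite m1l // (allP lt).
have [|w1 w2 w3 w4] := c2P m1 X.
  by apply/allP => x xl; rewrite m1l ?(allP lt) // (allP le).
rewrite E1 in w1 w2; set m2 := (exec c2 m1).1 in w1 w3.
set v := map m loc in m1s E1 w1 w2 *.
have sv : size v = k by rewrite size_map.
have vX : all (fun a => a <= X) v by rewrite all_map.
have loop i : i <= g v -> let q := iter i (fun p => let q := exec body p.1 in (q.1, p.2 + q.2)) (m2, 1) in
    [/\ q.1 s = iteri i (fun j x => step [:: j, x & v]) (init v), q.1 s.+1 = i,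
        forall x, x < s -> q.1 x = m x & q.2 <= 1 + i * T X].
  elim: i => [|i IH] lti /=.
    split=> //; first by rewrite w3 // m1s.
      by rewrite w3 // /m1 /upd eqxx.
    by move=> x xs; rewrite w3 ?m1l // ltnW // ltnW.
  case: (IH (ltnW lti)); set q := iter i _ _ => q1 q2 q3 q4.
  have Eq : map q.1 loc = v by apply/eq_in_map => x xl; rewrite q3 // (allP lt).
  have [|u1 u2 u3 u4] := c3P q.1 (Y X).
    rewrite /= q1 q2; apply/and3P; split.
    - apply: leq_trans (ltnW lti) _; apply: leq_trans w2 _.
      by rewrite /Y addnAC leq_addl.
    - by apply: leq_trans (small v X i sv vX (ltnW lti)) _; rewrite /Y -addnA leq_addr.
    - apply/allP => x xl; rewrite q3 ?(allP lt) //; apply: leq_trans (allP le _ xl) _.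
      exact: leq_addl.
  rewrite /= Eq q1 q2 in u1; split.
  - by rewrite /upd ltn_eqF // eqxx u1.
  - by rewrite /upd eqxx (gtn_eqF (ltnSn s)) u3 // q2.
  - move=> x xs; have xs1 : x < s.+1 by exact: ltnW.
    by rewrite /upd (ltn_eqF xs1) (ltn_eqF xs) u3 ?q3 //; exact: leq_trans xs (leq_addl 3 s).
  - by rewrite /= mulSn [leqRHS]addnCA [leqLHS]addnC leq_add // /T leq_add.
have /loop[u1 u2 u3 u4] := leqnn (g v).
rewrite -w1 in u1 u2 u3 u4; set q := iter _ _ _ in u1 u2 u3 u4.
have -> : exec (Seq (Seq c1 (Const s.+1 0)) (Seq c2 (Loop s.+2 body))) m =
  (q.1, (exec c1 m).2 + 1 + ((exec c2 m1).2 + q.2)) by [].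
split=> //=.
- by rewrite u1 w1.
- apply: leq_trans (small v X _ sv vX (leqnn _)) _.
  by move: (_ ^ di) (_ ^ dg) (_ ^ d) (_ * _) => *; lia.
- have le2 : m2 s.+2 * T X <= (X + 2) ^ dg * T X by rewrite leq_mul2r w1 w2 orbT.
  move: {+}(exec c1 m).2 {+}(exec c2 m1).2 {+}q.2 v4 w4 u4 le2 => x1 x2 x3.
  by move: (_ ^ d) (_ ^ di) (_ ^ dg) (_ * _) (_ * _) => *; lia.
Qed.

Lemma computes_poly_time k f : computes k f -> poly_time (fun v : k.-tuple nat => f v).
Proof.
move=> [d cf]; have [|c cP] := cf (iota 0 k) k (size_iota _ _).
  by apply/allP => x; rewrite mem_iota.
exists (Seq c (Copy 0 k)), d.+1 => v.
have Ev := map_nth_args (size_tuple v).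
have [|v1 v2 v3 v4] := cP (nth 0 v) (sumn v).
  rewrite -(all_map _ (fun a => a <= sumn v)) Ev; apply/allP => a av.
  by rewrite sumnE (big_rem a) //= leq_addr.
rewrite Ev in v1; split=> /=; first by rewrite /upd eqxx v1.
have b1 := base_gt0 (sumn v) d; rewrite expnS.
apply: (@leq_trans (2 * (sumn v + 2) ^ d)); last by rewrite leq_mul2r leq_addl orbT.
by rewrite mul2n -addnn leq_add.
Qed.

Notation decides k P := (computes k (fun v => nat_of_bool (P v))).

Lemma computes_op1 F : computes 1 (fun v => F (nth 0 v 0)) ->
  forall k f, computes k f -> computes k (fun v => F (f v)).
Proof.
move=> cF k f cf.
by apply: (@computes_comp k (fun v => F (nth 0 v 0)) [:: f] cF); case.
Qed.

Lemma computes_op2 F : computes 2 (fun v => F (nth 0 v 0) (nth 0 v 1)) ->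
  forall k f g, computes k f -> computes k g -> computes k (fun v => F (f v) (g v)).
Proof.
move=> cF k f g cf cg.
by apply: (@computes_comp k (fun v => F (nth 0 v 0) (nth 0 v 1)) [:: f; g] cF); case=> [|[|]].
Qed.

Lemma computes_S k f : computes k f -> computes k (fun v => (f v).+1).
Proof. exact: computes_op1 computes_succ k f. Qed.

Lemma computes_P k f : computes k f -> computes k (fun v => (f v).-1).
Proof. exact: computes_op1 computes_pred k f. Qed.

Lemma all2_le (X a b : nat) : all (fun x => x <= X) [:: a; b] -> a <= X /\ b <= X.
Proof. by case/and3P. Qed.

Lemma computes_add k f g : computes k f -> computes k g -> computes k (fun v => f v + g v).
Proof.
apply: (@computes_op2 addn).
apply: (@computes_ext _ (fun v => iteri (nth 0 v 1) (fun j x => (nth 0 [:: j, x & v] 1).+1) (nth 0 v 0))).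
  by move=> v _ /=; elim: (nth 0 v 1) => [|n IH] /=; rewrite ?addn0 // IH addnS.
apply: (@computes_iteri 2 (nth 0 ^~ 1) (fun u => (nth 0 u 1).+1) (nth 0 ^~ 0)).
- exact: computes_arg.
- by apply: computes_S; exact: computes_arg.
- exact: computes_arg.
- exists 2 => -[|a [|b [|? ?]]] // X i _ /all2_le[aX bX] /= ib.
have -> : iteri i (fun _ : nat => succn) a = a + i.
  by elim: i {ib} => [|i IH] /=; rewrite ?addn0 // IH addnS.
have -> : (X + 2) ^ 2 = X * X + 4 * X + 4 by ring.
by lia.
Qed.

Lemma computes_sub k f g : computes k f -> computes k g -> computes k (fun v => f v - g v).
Proof.
have E i a : iteri i (fun _ x => x.-1) a = a - i.
  by elim: i => [|i IH] /=; rewrite ?subn0 // IH subnS.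
apply: (@computes_op2 subn).
apply: (@computes_ext _ (fun v => iteri (nth 0 v 1) (fun j x => (nth 0 [:: j, x & v] 1).-1) (nth 0 v 0))).
  by move=> v _; exact: E.
apply: (@computes_iteri 2 (nth 0 ^~ 1) (fun u => (nth 0 u 1).-1) (nth 0 ^~ 0)).
- exact: computes_arg.
- by apply: computes_P; exact: computes_arg.
- exact: computes_arg.
- exists 1 => -[|a [|b [|? ?]]] // X i _ /all2_le[aX bX] /= ib.
by rewrite E expn1; lia.
Qed.

Lemma computes_mul k f g : computes k f -> computes k g -> computes k (fun v => f v * g v).
Proof.
have E i a : iteri i (fun _ x => x + a) 0 = a * i.
  by elim: i => [|i IH] /=; rewrite ?muln0 // IH mulnS addnC.
apply: (@computes_op2 muln).
apply: (@computes_ext _ (fun v => iteri (nth 0 v 1)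
  (fun j x => nth 0 [:: j, x & v] 1 + nth 0 [:: j, x & v] 2) 0)).
  by move=> v _; exact: E.
apply: (@computes_iteri 2 (nth 0 ^~ 1) (fun u => nth 0 u 1 + nth 0 u 2) (fun=> 0)).
- exact: computes_arg.
- by apply: computes_add; exact: computes_arg.
- exact: computes_const.
- exists 2 => -[|a [|b [|? ?]]] // X i _ /all2_le[aX bX] /= ib.
rewrite E expnS expn1 leq_mul //; first by lia.
by apply: leq_trans (leq_trans ib bX) _; lia.
Qed.

Lemma computes_neg k (P : seq nat -> bool) : decides k P -> decides k (fun v => ~~ P v).
Proof.
move=> cP; apply: computes_ext (computes_sub (computes_const k 1) cP) => v _.
by case: (P v).
Qed.

Lemma computes_and k (P Q : seq nat -> bool) :
  decides k P -> decides k Q -> decides k (fun v => P v && Q v).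
Proof.
by move=> cP cQ; apply: computes_ext (computes_mul cP cQ) => v _; exact: mulnb.
Qed.

Lemma computes_or k (P Q : seq nat -> bool) :
  decides k P -> decides k Q -> decides k (fun v => P v || Q v).
Proof.
move=> cP cQ; apply: computes_ext (computes_neg (computes_and (computes_neg cP) (computes_neg cQ))).
by move=> v _; rewrite negb_and !negbK.
Qed.

Lemma computes_leq k f g : computes k f -> computes k g -> decides k (fun v => f v <= g v).
Proof.
move=> cf cg.
apply: computes_ext (computes_sub (computes_const k 1) (computes_sub cf cg)) => v _ /=.
by rewrite /leq; case: (f v - g v).
Qed.

Lemma computes_eq k f g : computes k f -> computes k g -> decides k (fun v => f v == g v).
Proof.
move=> cf cg.
apply: computes_ext (computes_and (computes_leq cf cg) (computes_leq cg cf)) => v _ /=.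
by rewrite -eqn_leq.
Qed.

Lemma computes_lt k f g : computes k f -> computes k g -> decides k (fun v => f v < g v).
Proof. by move=> cf cg; apply: computes_leq => //; exact: computes_S. Qed.

Lemma computes_min k f g : computes k f -> computes k g -> computes k (fun v => minn (f v) (g v)).
Proof.
move=> cf cg; apply: computes_ext (computes_sub cf (computes_sub cf cg)) => v _.
by rewrite minnE.
Qed.

Lemma iteri_count i (P : nat -> bool) : iteri i (fun j x => x + P j) 0 = \sum_(j < i) P j.
Proof. by elim: i => [|i IH]; rewrite ?big_ord0 // big_ord_recr /= IH. Qed.

Lemma sum_bool_le i (P : nat -> bool) : \sum_(j < i) P j <= i.
Proof.
rewrite -[leqRHS]card_ord -sum1_card; apply: leq_sum => j _; exact: leq_b1.
Qed.

Lemma computes_count k g (P : nat -> seq nat -> bool) : computes k g ->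
  decides k.+2 (fun u => P (nth 0 u 0) (drop 2 u)) ->
  computes k (fun v => \sum_(j < g v) P j v).
Proof.
move=> cg cP; pose step u := nth 0 u 1 + P (nth 0 u 0) (drop 2 u).
have E v i : iteri i (fun j x => step [:: j, x & v]) 0 = \sum_(j < i) P j v.
  rewrite -(iteri_count i (fun j => P j v)); elim: i => //= i ->; by rewrite /step /= drop0.
apply: (@computes_ext _ (fun v => iteri (g v) (fun j x => step [:: j, x & v]) 0)) => [v _|].
  exact: E.
apply: (computes_iteri cg _ (computes_const _ _)).
  by apply: computes_add cP; exact: computes_arg.
have [d gd] := computes_value cg; exists d => v X i sv vX ig.
rewrite E; apply: leq_trans (sum_bool_le i (fun j => P j v)) _.
exact: leq_trans ig (gd _ _ sv vX).
Qed.

Lemma sum_lt n q : \sum_(j < n) (j < q) = minn n q.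
Proof.
elim: n => [|n IH]; first by rewrite big_ord0 min0n.
by rewrite big_ord_recr /= IH; case: (ltnP n q); lia.
Qed.

Lemma computes_dropped k i : i < k -> computes k.+2 (fun u => nth 0 (drop 2 u) i).
Proof.
move=> ik; apply: (@computes_ext _ (fun u => nth 0 u i.+2)); last exact: computes_arg.
by move=> u _; rewrite nth_drop.
Qed.

(** The quotient is the number of positive multiples of the divisor up to the
    dividend, except for the divisor 0. *)
Lemma computes_div k f g : computes k f -> computes k g -> computes k (fun v => f v %/ g v).
Proof.
apply: (@computes_op2 divn).
apply: (@computes_ext _ (fun v => (0 < nth 0 v 1) *
    \sum_(j < nth 0 v 0) (nth 0 v 1 * j.+1 <= nth 0 v 0))) => [v _|].
  move: (nth 0 v 0) (nth 0 v 1) => x [|d]; first by rewrite divn0.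
  rewrite mul1n (eq_bigr (fun j : 'I_x => (j < x %/ d.+1) : nat)) => [|j _].
    by rewrite sum_lt; apply/minn_idPr; exact: leq_div.
  by rewrite leq_divRL // mulnC.
apply: computes_mul; first by apply: computes_lt; [exact: computes_const | exact: computes_arg].
apply: (@computes_count 2 (nth 0 ^~ 0) (fun j v => nth 0 v 1 * j.+1 <= nth 0 v 0)).
  exact: computes_arg.
apply: computes_leq; last exact: computes_dropped.
by apply: computes_mul; [exact: computes_dropped | apply: computes_S; exact: computes_arg].
Qed.

Lemma computes_mod k f g : computes k f -> computes k g -> computes k (fun v => f v %% g v).
Proof.
move=> cf cg; apply: computes_ext (computes_sub cf (computes_mul (computes_div cf cg) cg)) => v _.
by rewrite {1}(divn_eq (f v) (g v)) addKn.
Qed.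

(** ** The edge relation is computable *)

Section Relation.
Variable t : nat.
Hypothesis t_ge2 : 2 <= t.

(** Powers are capped, since an uncapped power is not polynomially bounded. *)
Definition capped_exp b e := iteri e (fun _ x => minn (t * x) b) 1.

Lemma capped_expE b e : 0 < b -> capped_exp b e = minn (t ^ e) b.
Proof.
move=> b0; elim: e => [|e IH]; first by rewrite expn0; apply/esym/minn_idPl.
have -> : capped_exp b e.+1 = minn (t * capped_exp b e) b by [].
rewrite IH expnS; move: (t ^ e) => p; have t0 := ltnW t_ge2.
have [pb|/ltnW bp] := leqP p b; first by [].
have le q : b <= q -> minn (t * q) b = b.
  by move=> bq; apply/minn_idPr; apply: leq_trans bq _; exact: leq_pmull.
by rewrite !le.
Qed.

Lemma computes_capped_exp k f g : computes k f -> computes k g ->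
  computes k (fun v => capped_exp (f v) (g v)).
Proof.
apply: (@computes_op2 capped_exp).
apply: (@computes_iteri 2 (nth 0 ^~ 1) (fun u => minn (t * nth 0 u 1) (nth 0 u 2)) (fun=> 1)).
- exact: computes_arg.
- apply: computes_min; last exact: computes_arg.
  by apply: computes_mul; [exact: computes_const | exact: computes_arg].
- exact: computes_const.
exists 1 => -[|b [|e [|? ?]]] // X i _ /all2_le[bX eX] /= ib; rewrite expn1.
case: i {ib} => [|i] /=; first by rewrite addn2.
by apply: leq_trans (geq_minr _ _) (leq_trans bX (leq_addr _ _)).
Qed.

Lemma heightE n :
  height t n = iteri n (fun _ L => L + (capped_exp n (6 * L) < n)) 0.
Proof.
rewrite /height; case: n => // n; move: {1 3}n.+1 => i.
elim: i => //= i ->; congr (_ + _); rewrite capped_expE //.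
by rewrite gtn_min ltnn orbF.
Qed.

Lemma computes_height k f : computes k f -> computes k (fun v => height t (f v)).
Proof.
apply: (@computes_op1 (height t)).
apply: computes_ext (fun v _ => esym (heightE (nth 0 v 0))) _.
apply: (@computes_iteri 1 (nth 0 ^~ 0)
  (fun u => nth 0 u 1 + (capped_exp (nth 0 u 2) (6 * nth 0 u 1) < nth 0 u 2)) (fun=> 0)).
- exact: computes_arg.
- apply: computes_add; first exact: computes_arg.
  apply: computes_lt; last exact: computes_arg.
  apply: computes_capped_exp; first exact: computes_arg.
  by apply: computes_mul; [exact: computes_const | exact: computes_arg].
- exact: computes_const.
exists 1 => -[|n [|? ?]] // X i _ /=; rewrite andbT expn1 => nX iX.
apply: (@leq_trans i); last by lia.
elim: i {iX} => //= i IH; rewrite -[i.+1]addn1 leq_add //; exact: leq_b1.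
Qed.

(** The powers of [t] that occur in the construction are at most
    [t ^ (6 * height t n + 5)]. *)
Definition pow n e := capped_exp (t ^ 11 * n.+1) e.

Lemma powE n e : e <= 6 * height t n + 5 -> pow n e = t ^ e.
Proof.
move=> le; have b0 : 0 < t ^ 11 * n.+1 by rewrite muln_gt0 texp_gt0.
rewrite /pow capped_expE //; apply/minn_idPl.
apply: (@leq_trans (t ^ (5 + 6 * height t n))); first by rewrite leq_pexp2l ?(ltnW t_ge2) // addnC.
rewrite expnD -[11]/(5 + 6) [in leqRHS]expnD -mulnA leq_mul2l; apply/orP; right.
case: n {le b0} => [|n].
  by rewrite muln1 leq_pexp2l // (ltnW t_ge2).
by apply: leq_trans (height_le t_ge2 _) _; rewrite // leq_mul2l leqnSn orbT.
Qed.

Lemma computes_pow k f g : computes k f -> computes k g -> computes k (fun v => pow (f v) (g v)).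
Proof.
move=> cf cg; apply: computes_capped_exp cg; apply: computes_mul; first exact: computes_const.
exact: computes_S.
Qed.

(** The dimensions of the labelling in terms of [n], by capped powers; they have
    their true values for [j <= height t n]. *)
Definition cap_of n j := 10 * pow n (2 * j + 5).
Definition width_of n j := pow n (3 * (height t n - j)).
Definition size_of n j := 10 * pow n (6 * (height t n - j) + (2 * j + 5)).

Lemma cap_ofE n j : j <= height t n -> cap_of n j = cap t j.
Proof. by move=> le; rewrite /cap_of powE //; lia. Qed.

Lemma width_ofE n j : width_of n j = width t (height t n) j.
Proof. by rewrite /width_of powE //; lia. Qed.

Lemma size_ofE n j : j <= height t n -> size_of n j = size_at t (height t n) j.
Proof. by move=> le; rewrite size_atE // /size_of powE //; lia. Qed.

Section Coordinates.
Variables (k : nat) (f g : seq nat -> nat).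
Hypotheses (cf : computes k f) (cg : computes k g).
Local Notation c2 op := (fun v => op (f v) (g v)).

Lemma computes_cap_of : computes k (c2 cap_of).
Proof.
apply: computes_mul; first exact: computes_const.
apply: computes_pow cf _; apply: computes_add; last exact: computes_const.
by apply: computes_mul cg; exact: computes_const.
Qed.

Lemma computes_width_of : computes k (c2 width_of).
Proof.
apply: computes_pow cf _; apply: computes_mul; first exact: computes_const.
by apply: computes_sub cg; exact: computes_height.
Qed.

Lemma computes_size_of : computes k (c2 size_of).
Proof.
apply: computes_mul; first exact: computes_const.
apply: computes_pow cf _; apply: computes_add.
  apply: computes_mul; first exact: computes_const.
  by apply: computes_sub cg; exact: computes_height.
apply: computes_add; last exact: computes_const.
by apply: computes_mul cg; exact: computes_const.
Qed.

End Coordinates.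

Section Labels.
Variables (k : nat) (n x : seq nat -> nat).
Hypotheses (cn : computes k n) (cx : computes k x).
Local Notation L v := (height t (n v)).

Lemma computes_level : computes k (fun v => level t (L v) (x v)).
Proof.
move: k n x cn cx; apply: (@computes_op2 (fun n x => level t (height t n) x)).
apply: (@computes_ext _ (fun v => \sum_(j < height t (nth 0 v 0))
   (nth 0 v 1 < size_of (nth 0 v 0) j))) => [v _|].
  by apply: eq_bigr => j _; rewrite size_ofE // ltnW.
apply: (@computes_count 2 (fun v => height t (nth 0 v 0))
  (fun j v => nth 0 v 1 < size_of (nth 0 v 0) j)).
  by apply: computes_height; exact: computes_arg.
apply: computes_lt; first exact: computes_dropped.
by apply: computes_size_of; [exact: computes_dropped | exact: computes_arg].
Qed.

Lemma computes_block1 : computes k (fun v => block1 t (L v) (x v)).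
Proof.
have lev := computes_level; have sz := computes_size_of cn lev.
have wd := computes_width_of cn lev; have cp := computes_cap_of cn lev.
apply: computes_ext (computes_div (computes_sub cx sz) (computes_mul wd cp)) => v _ /=.
by rewrite /block1 size_ofE ?width_ofE ?cap_ofE // level_le.
Qed.

Lemma computes_block2 : computes k (fun v => block2 t (L v) (x v)).
Proof.
have lev := computes_level; have sz := computes_size_of cn lev.
have wd := computes_width_of cn lev; have cp := computes_cap_of cn lev.
apply: computes_ext (computes_mod (computes_div (computes_sub cx sz) cp) wd) => v _ /=.
by rewrite /block2 size_ofE ?width_ofE ?cap_ofE // level_le.
Qed.

Lemma decides_is_label : decides k (fun v => is_label t (L v) (x v)).
Proof.
have lev := computes_level; have sz := computes_size_of cn lev.
apply: computes_ext (computes_and (computes_leq sz cx)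
  (computes_lt cx (computes_mul (computes_const k 2) sz))) => v _ /=.
by rewrite /is_label size_ofE // level_le.
Qed.

End Labels.

Lemma decides_near k lx bx ly by_ : computes k lx -> computes k bx -> computes k ly ->
  computes k by_ -> decides k (fun v => near t (lx v) (bx v) (ly v) (by_ v)).
Proof.
move=> clx cbx cly cby; have ct := computes_const k (t ^ 3).
apply: computes_or; first by apply: computes_and; exact: computes_eq.
by apply: computes_or; apply: computes_and; apply: computes_eq => //;
  (exact: computes_S || exact: computes_div).
Qed.

Section Tied.
Variables (k : nat) (n x y : seq nat -> nat).
Hypotheses (cn : computes k n) (cx : computes k x) (cy : computes k y).
Local Notation L v := (height t (n v)).

Lemma decides_near1 : decides k (fun v => near1 t (L v) (x v) (y v)).
Proof. by apply: decides_near; (exact: computes_level || exact: computes_block1). Qed.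

Lemma decides_near2 : decides k (fun v => near2 t (L v) (x v) (y v)).
Proof. by apply: decides_near; (exact: computes_level || exact: computes_block2). Qed.

Lemma decides_tied2 : decides k (fun v => tied2 t (L v) (x v) (y v)).
Proof.
apply: computes_and; first exact: decides_is_label.
apply: computes_and; first exact: decides_is_label.
by apply: computes_and; [exact: decides_near1 | exact: decides_near2].
Qed.

End Tied.

Lemma decides_tied3 k n x y z : computes k n -> computes k x -> computes k y -> computes k z ->
  decides k (fun v => tied3 t (height t (n v)) (x v) (y v) (z v)).
Proof.
move=> cn cx cy cz; apply: computes_and; first exact: decides_tied2.
apply: computes_and; first exact: decides_is_label.
apply: computes_or; first exact: decides_near1.
apply: computes_or; first exact: decides_near1.
by apply: computes_or; exact: decides_near2.
Qed.

Lemma decides_edge_seq k n hs : computes k n ->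
  (forall i, i < size hs -> computes k (nth (fun=> 0) hs i)) ->
  decides k (fun v => edge_seq t (n v) [seq h v | h <- hs]).
Proof.
move=> cn; have [m] := ubnP (size hs); elim: m hs => // m IH [|x [|y [|z [|z' hs]]]] lt chs.
- exact: computes_const.
- exact: computes_const.
- apply: computes_ext (decides_tied2 cn (chs 0 isT) (chs 1 isT)) => v _ /=.
  by rewrite /edge_seq /= andbT.
- exact: decides_tied3 cn (chs 0 isT) (chs 1 isT) (chs 2 isT).
- apply: computes_and; first exact: decides_tied2 cn (chs 0 isT) (chs 1 isT).
  apply: (IH [:: z, z' & hs]); first by move: lt => /=; lia.
  by move=> i lti; exact: (chs i.+2 lti).
Qed.

Lemma decides_has (T : eqType) k (P : T -> seq nat -> bool) s :
  {in s, forall q, decides k (P q)} -> decides k (fun v => has (P^~ v) s).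
Proof.
elim: s => [|q s IH] cP; first exact: computes_const.
apply: computes_or; first by apply: cP; exact: mem_head.
by apply: IH => q' q's; apply: cP; rewrite inE q's orbT.
Qed.

Lemma decides_uniq k hs : (forall i, i < size hs -> computes k (nth (fun=> 0) hs i)) ->
  decides k (fun v => uniq [seq h v | h <- hs]).
Proof.
elim: hs => [|h hs IH] chs; first exact: computes_const.
apply: computes_and; last by apply: IH => i; exact: (chs i.+1).
apply: computes_neg; have ch : computes k h := chs 0 isT.
have {}chs i : i < size hs -> computes k (nth (fun=> 0) hs i) by exact: (chs i.+1).
elim: hs chs {IH} => [|h' hs IH] chs; first exact: computes_const.
apply: (@computes_ext _ (fun v => (h v == h' v) || (h v \in [seq h v | h <- hs]))) => //.
apply: computes_or; first by apply: computes_eq ch (chs 0 isT).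
by apply: IH => i; exact: (chs i.+1).
Qed.

Lemma poly_time_num_vertices : poly_time (fun v : 1.-tuple nat => num_vertices t (thead v)).
Proof.
have cn : computes 1 (fun v => nth 0 v 0) by exact: computes_arg.
have sz := computes_size_of cn (computes_const 1 0).
have [p [d pP]] := computes_poly_time (computes_mul (computes_const 1 2) sz).
exists p, d => v; have [v1 v2] := pP v; split=> //; rewrite v1 /= size_ofE //.
by rewrite /num_vertices /thead (tnth_nth 0).
Qed.

Variable r : nat.

Lemma has_permutations (P : pred (seq nat)) vs :
  has P (permutations vs) =
  has (fun q => P [seq nth 0 vs i | i <- q]) (permutations (iota 0 (size vs))).
Proof.
apply/hasP/hasP => -[s]; rewrite mem_permutations => sP Ps.
  have [q qP Es] := perm_iotaP 0 sP.
  by exists q; rewrite ?mem_permutations -?Es.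
exists [seq nth 0 vs i | i <- s] => //.
by rewrite mem_permutations -{2}(map_nth_args (erefl (size vs))) perm_map.
Qed.

(** For fixed [r], there are boundedly many ways to order [r] vertices. *)
Lemma poly_time_edge_test : poly_time (edge_test (edge_set t r) (r := r)).
Proof.
pose hs q := [seq nth 0 ^~ i.+1 | i <- q] : seq (seq nat -> nat).
have hsE q n vs : [seq h (n :: vs) | h <- hs q] = [seq nth 0 vs i | i <- q].
  by rewrite -map_comp.
have c_hs q : perm_eq q (iota 0 r) ->
    forall i, i < size (hs q) -> computes r.+1 (nth (fun=> 0) (hs q) i).
  move=> pq i; rewrite size_map => lt.
  rewrite (nth_map 0) //; apply: computes_arg; rewrite ltnS.
  by have := mem_nth 0 lt; rewrite (perm_mem pq) mem_iota => /andP[].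
have c1 := decides_uniq (c_hs _ (perm_refl _)).
have c2 : decides r.+1 (fun v => has (fun q => edge_seq t (nth 0 v 0) [seq h v | h <- hs q])
    (permutations (iota 0 r))).
  apply: (@decides_has _ _ (fun q v => edge_seq t (nth 0 v 0) [seq h v | h <- hs q])) => q.
  rewrite mem_permutations => qP; apply: decides_edge_seq; last exact: c_hs.
  exact: computes_arg.
have [p [d pP]] := computes_poly_time (computes_and c1 c2).
exists p, d => v; have [v1 v2] := pP v; split=> //; rewrite v1 {pP v1 v2}.
case/tupleP: v => n vs; have sz := size_tuple vs.
have -> : edge_test (edge_set t r) [tuple of n :: vs] = (members t n vs \in edge_set t r n).
  by [].
rewrite members_edge // [in RHS]has_permutations sz; congr (nat_of_bool (_ && _)).
  by rewrite -[in RHS](map_nth_args sz) -(hsE _ n).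
by apply: eq_has => q; rewrite -(hsE _ n).
Qed.

End Relation.

(** * The theorem *)

Section Sizes.
Import Order.TTheory GRing.Theory Num.Theory.
Local Open Scope ring_scope.
Variables (R : realType) (t : nat).
Hypothesis t_ge2 : (2 <= t)%N.

Lemma powR_half (x : R) r : 0 <= x -> x `^ (r%:R / 2%:R) = Num.sqrt x ^+ r.
Proof.
by move=> x0; rewrite mulrC powRrM powR12_sqrt // powR_mulrn // sqrtr_ge0.
Qed.

Lemma num_vertices_le n : (0 < n)%N -> (num_vertices t n <= 20 * t ^ 5 * t ^ 6 * n)%N.
Proof.
move=> n0; rewrite num_verticesE //; move: (height_le t_ge2 n0); move: (t ^ _)%N (t ^ 5)%N (t ^ 6)%N.
by move=> a b c le; rewrite -[leqRHS]mulnA leq_mul2l le orbT.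
Qed.

Lemma num_edges_le r n : (0 < n)%N ->
  #|edge_set t r n|%:R <= ((edge_factor t * t ^ 3) ^ r)%:R * (n%:R `^ (r%:R / 2%:R)) :> R.
Proof.
move=> n0; rewrite powR_half ?ler0n // natrX -exprMn.
apply: (@le_trans _ _ ((edge_factor t * t ^ (3 * height t n)) ^ r)%:R).
  by rewrite ler_nat card_edge_set.
rewrite natrX lerXn2r ?nnegrE ?ler0n ?mulr_ge0 ?sqrtr_ge0 //.
rewrite natrM [X in _ <= X * _]natrM -mulrA ler_wpM2l ?ler0n //.
have -> : (t ^ (3 * height t n))%:R = Num.sqrt ((t ^ (6 * height t n))%:R : R).
  have -> : (t ^ (6 * height t n) = (t ^ (3 * height t n)) ^ 2)%N.
    by rewrite -expnM; congr expn; lia.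
  by rewrite [in RHS]natrX sqrtr_sqr ger0_norm ?ler0n.
have -> : (t ^ 3)%:R = Num.sqrt ((t ^ 6)%:R : R).
  by rewrite -[6%N]/(3 * 2)%N expnM [in RHS]natrX sqrtr_sqr ger0_norm ?ler0n.
by rewrite -sqrtrM ?ler0n // -natrM ler_wsqrtr // ler_nat height_le.
Qed.

End Sizes.

Import GRing.Theory Num.Theory.

Theorem theorem1p3 (R : realType) (r : nat) (hr : (2 <= r)%N) :
  exists (C : R) (N : nat -> nat) (E : forall n : nat, {set {set 'I_(N n)}}),
    explicitly_constructible r E /\
    forall n : nat, (0 < n)%N ->
      [/\ uniform r (Hypergraph (E n)),
          universal (bounded_family r n 2) (Hypergraph (E n)),
          ((N n)%:R <= C * n%:R)%R
        & (#|E n|%:R <= C * (n%:R `^ (r%:R / 2%:R)))%R].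
Proof.
have [t tE] : exists t, t = 2 ^ 8 by exists (2 ^ 8).
have t_ge2 : 2 <= t by rewrite tE.
pose K1 := 20 * t ^ 5 * t ^ 6; pose K2 := (edge_factor t * t ^ 3) ^ r.
have K_ge (K : nat) (a x : R) : (0 <= x)%R -> (a <= K%:R * x)%R -> K <= K1 + K2 ->
    (a <= (K1 + K2)%:R * x)%R.
  by move=> x0 ax KK; apply: (Order.POrderTheory.le_trans ax); rewrite ler_wpM2r ?ler_nat.
exists (K1 + K2)%:R%R, (num_vertices t), (edge_set t r); split.
  by split; [exact: poly_time_num_vertices | exact: poly_time_edge_test].
move=> n n0; split.
- exact: uniform_edges.
- exact: universal_edges.
- apply: (K_ge K1); rewrite ?ler0n ?leq_addr //.
  by rewrite -natrM ler_nat num_vertices_le.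
- apply: (K_ge K2); rewrite ?powR_ge0 ?leq_addl //.
  exact: num_edges_le.
Qed.
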